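(* Let $\lambda$ be a partition. Then $$G_\lambda(x;y)=\lim_{k\to\infty}G_\lambda(x_1,\dots,x_k\,|\,y),$$ where $G_\lambda(x;y)$ is the double stable Grothendieck polynomial (a power series in $x=(x_1,x_2,\dots)$ and $y=(y_1,y_2,\dots)$) of $\lambda$, $G_\lambda(x_1,\dots,x_k|y)$ is the factorial Grothendieck polynomial in the $k$ variables $x_1,\dots,x_k$ with second sequence of variables $y$, and the limit is taken coefficientwise (the coefficient of each fixed monomial is eventually constant).
   Context: $\beta$ is an indeterminate and $x\oplus y=x+y+\beta xy$. Factorial Grothendieck polynomials. A partition is identified with its Young diagram (box $(i,j)$ in row $i$ from the top, column $j$); the content of $\alpha=(i,j)$ is $c(\alpha)=j-i$; $|\lambda|$ is the number of boxes. A set-valued $\lambda$-tableau $T$ with entries in $[k]=\{1,\dots,k\}$ assigns to each box $\alpha$ a non-empty set $T(\alpha)\subset[k]$ such that $\max T(\alpha)\le\min T(\alpha')$ if $\alpha$ is immediately left of $\alpha'$, and $\max T(\alpha)<\min T(\alpha')$ if $\alpha$ is immediately above $\alpha'$; $|T|=\sum_\alpha|T(\alpha)|$. Then $$G_\lambda(x_1,\dots,x_k|y)=\sum_T\beta^{|T|-|\lambda|}\prod_{\alpha\in\lambda,\ r\in T(\alpha)}\bigl(x_r\oplus y_{r+c(\alpha)}\bigr),$$ the sum being over all set-valued $\lambda$-tableaux with entries in $[k]$ (only $y_i$ with $i\ge1$ occur). Double Grothendieck polynomials. For $w\in S_{N+1}$, with simple reflections $s_i=(i,i+1)$ and length $\ell(w)=\#\{i<j: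 w(i)>w(j)\}$, define $\mathcal{G}_w$ as follows. The isobaric divided difference operators act on polynomials $f$ in the $x$-variables by $$\pi_if=\frac{(1+\beta x_{i+1})f(\dots,x_i,x_{i+1},\dots)-(1+\beta x_i)f(\dots,x_{i+1},x_i,\dots)}{x_i-x_{i+1}}.$$ For the longest element $w_0=(N+1,N,\dots,1)$ of $S_{N+1}$ put $\mathcal{G}_{w_0}=\prod_{i+j\le N+1}(x_i\oplus y_j)$; for $w\ne w_0$ put $\mathcal{G}_w=\pi_i\mathcal{G}_{ws_i}$ for any $i$ with $\ell(ws_i)>\ell(w)$ (this is independent of the choice of $i$). For $w\in S_{N+1}$, $1^m\times w\in S_{m+N+1}$ is the permutation fixing $1,\dots,m$ and sending $i>m$ to $m+w(i-m)$. The double stable Grothendieck polynomial is the power series $G_w(x;y)=\lim_{m\to\infty}\mathcal{G}_{1^m\times w}$ (coefficientwise limit, which exists). For a partition $\lambda$ choose any $p\ge\ell(\lambda)$ (with $\lambda_k=0$ for $k>\ell(\lambda)$) and let $w(\lambda)$ be the permutation of the positive integers with $w(\lambda)(i)=i+\lambda_{p+1-i}$ for $1\le i\le p$ and $w(\lambda)(i)=i-\lambda'_{i-p}$ for $i>p$, where $\lambda'$ is the conjugate partition (it fixes all but finitely many integers). Define $G_\lambda(x;y)=G_{w(\lambda)}(x;y)$; this is independent of $p$. *)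

(* Defs.v *)
From HB Require Import structures.
From mathcomp Require Import all_boot all_order all_fingroup all_algebra.
From mathcomp Require Import finmap monalg zify.
From Stdlib Require Import ClassicalEpsilon.

Set Implicit Arguments.
Unset Strict Implicit.
Unset Printing Implicit Defensive.

Import GRing.Theory.

Local Open Scope ring_scope.

(* The variables: [inl i] is x_i and [inr j] is y_j.  Indices are 1-based, as
   usual for these polynomials; x_0 and y_0 are present in the ring but do not
   occur in anything below. *)
Definition var : Type := (nat + nat)%type.

Definition mon : Type := {cmonom var}.

(* Z[beta][x_1, x_2, ..., y_1, y_2, ...], with beta the variable of
   {poly int}. *)
Definition bpoly : Type := {malg {poly int}[{cmonom var}]}.
HB.instance Definition _ := GRing.ComAlgebra.on bpoly.

(* Power series in the x's and y's over Z[beta]. *)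
Definition bseries : Type := mon -> {poly int}.

Definition pvar (v : var) : bpoly := << ucm v >>.
Definition px (i : nat) : bpoly := pvar (inl i).
Definition py (j : nat) : bpoly := pvar (inr j).
Definition beta : bpoly := malgC 'X.

Definition oplus (f g : bpoly) : bpoly := f + g + beta * f * g.

Definition converges (u : nat -> bpoly) (G : bseries) : Prop :=
  forall m : mon, exists K : nat, forall k : nat, (K <= k)%N -> (u k)@_m = G m.

(* The coefficientwise limit (unspecified if there is none; it is unique if it
   exists). *)
Definition clim (u : nat -> bpoly) : bseries :=
  epsilon (inhabits (fun=> 0)) (converges u).

(* Partitions *)

Definition is_partition (la : seq nat) : bool :=
  sorted geq la && (0 \notin la)%N.

(* Parts are 1-based: [part la i] is lambda_i, and 0 beyond the length. *)
Definition part (la : seq nat) (i : nat) : nat := nth 0%N la i.-1.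

Definition conj_part (la : seq nat) (j : nat) : nat := count (leq j) la.

(* Factorial Grothendieck polynomials.  Boxes and tableau entries are 0-based:
   [(i, j)] stands for the box (i+1, j+1) and [r : 'I_k] for the entry r+1.
   Contents are unaffected. *)

Definition box (la : seq nat) : Type :=
  {a : 'I_(size la) * 'I_(head 0%N la) | (a.2 < nth 0%N la a.1)%N}.
HB.instance Definition _ la := Finite.on (box la).

Definition brow la (a : box la) : nat := (val a).1.
Definition bcol la (a : box la) : nat := (val a).2.

Definition svfilling (la : seq nat) (k : nat) : Type :=
  {ffun box la -> {set 'I_k}}.
HB.instance Definition _ la k := Finite.on (svfilling la k).

Definition is_svtableau la k (T : svfilling la k) : bool :=
  [&& [forall a, T a != set0],
      [forall a, forall b,
         (brow b == brow a) && (bcol b == (bcol a).+1) ==>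
         [forall r in T a, forall s in T b, (r <= s)%N]] &
      [forall a, forall b,
         (brow b == (brow a).+1) && (bcol b == bcol a) ==>
         [forall r in T a, forall s in T b, (r < s)%N]]].

Definition svsize la k (T : svfilling la k) : nat := (\sum_a #|T a|)%N.

(* In a tableau the entries of row i are at least i, so the truncated
   subtractions below are exact: |T| >= |lambda|, and the index of y is the
   integer r + c(alpha) >= 1. *)
Definition factorialG (la : seq nat) (k : nat) : bpoly :=
  \sum_(T : svfilling la k | is_svtableau T)
    beta ^+ (svsize T - sumn la) *
    \prod_(a : box la) \prod_(r in T a)
      oplus (px r.+1) (py (r.+1 + bcol a - brow a)).

(* Double Grothendieck polynomials *)

Definition psubst (s : var -> bpoly) (f : bpoly) : bpoly :=
  \sum_(m <- msupp f)
    malgC f@_m * \prod_(v <- finsupp (cmonom_val m)) s v ^+ m v.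

Definition swap_var (i : nat) (v : var) : var :=
  if v == inl i then inl i.+1 else if v == inl i.+1 then inl i else v.

Definition swapx (i : nat) (f : bpoly) : bpoly :=
  psubst (fun v => pvar (swap_var i v)) f.

(* The quotient f / d when d divides f; it is unique if d is not a zero divisor,
   as for d = x_i - x_(i+1) below. *)
Definition exact_quotient (f d : bpoly) : bpoly :=
  epsilon (inhabits 0) (fun g : bpoly => g * d = f).

Definition isobaric (i : nat) (f : bpoly) : bpoly :=
  exact_quotient ((1 + beta * px i.+1) * f - (1 + beta * px i) * swapx i f)
                 (px i - px i.+1).

(* A permutation [w : 'S_n] acts on {0, ..., n-1}: [w i] = j stands for
   w(i+1) = j+1. *)

Definition perm_length n (w : 'S_n) : nat :=
  #|[set ij : 'I_n * 'I_n | (ij.1 < ij.2)%N && (w ij.2 < w ij.1)%N]|.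

(* The transposition of i and i+1; only used when i + 1 < n, since [ordS] is
   the cyclic successor. *)
Definition simple_refl n (i : 'I_n) : 'S_n := tperm i (ordS i).

Definition longest n : 'S_n := perm (@rev_ord_inj n).

(* [s * t] in 'S_n is "s, then t", so the product w s_i (apply s_i first) is
   [simple_refl i * w]. *)
Definition is_double_grothendieck n (F : 'S_n -> bpoly) : Prop :=
  F (longest n) = \prod_(1 <= i < n.+1) \prod_(1 <= j < n.+1 | (i + j <= n)%N)
                     oplus (px i) (py j)
  /\ forall (w : 'S_n) (i : 'I_n), (i.+1 < n)%N ->
       (perm_length w < perm_length (simple_refl i * w)%g)%N ->
       F w = isobaric i.+1 (F (simple_refl i * w)%g).

(* There is exactly one family satisfying the recursion for every choice of
   ascent i. *)
Definition double_grothendieck n : 'S_n -> bpoly :=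
  epsilon (inhabits (fun=> 0)) (@is_double_grothendieck n).

(* 1^m x w *)
Definition shift_fun m n (w : 'S_n) (i : 'I_(m + n)) : 'I_(m + n) :=
  match split i with inl j => lshift n j | inr j => rshift m (w j) end.

Fact shift_fun_inj m n (w : 'S_n) : injective (@shift_fun m n w).
Proof.
move=> i j; rewrite /shift_fun.
case: (split_ordP i) => i' ->; case: (split_ordP j) => j' -> /eqP.
- by rewrite eq_lshift => /eqP ->.
- by rewrite eq_lrshift.
- by rewrite eq_rlshift.
- by rewrite eq_rshift => /eqP/perm_inj ->.
Qed.

Definition shift_perm m n (w : 'S_n) : 'S_(m + n) :=
  perm (@shift_fun_inj m n w).

Definition stableG n (w : 'S_n) : bseries :=
  clim (fun m => double_grothendieck (shift_perm m w)).

(* The permutation w(lambda) of the positive integers attached to p. *)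
Definition grass_perm (la : seq nat) (p i : nat) : nat :=
  if (i <= p)%N then (i + part la (p.+1 - i))%N
  else (i - conj_part la (i - p))%N.

(* The permutation f of the positive integers lies in S_n, where it is w. *)
Definition represents n (w : 'S_n) (f : nat -> nat) : Prop :=
  (forall i : 'I_n, (w i).+1 = f i.+1) /\ (forall i, (n < i)%N -> f i = i).

Lemma part_conj la j a : is_partition la -> (0 < j)%N -> (0 < a)%N ->
  (j <= part la a)%N = (a <= conj_part la j)%N.
Proof.
case/andP=> la_s _ j0; case: a => // a _.
rewrite /part /conj_part /=.
elim: la a la_s => [|x la IHla] a //=; first by rewrite nth_nil leqn0; case: j j0.
move=> la_s; have la_s' := path_sorted la_s.
case: a => [|a] /=.
  case: (leqP j x) => //= xj; apply/esym/negbTE; rewrite -leqNgt leqn0.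
  rewrite -leqn0 leqNgt -has_count; apply/hasPn => y y_la.
  have /allP/(_ _ y_la) : all (geq x) la.
    by apply: order_path_min la_s => u v w /= uv /leq_trans; apply.
  by rewrite -ltnNge /= => /leq_ltn_trans; apply.
rewrite IHla //; case: (leqP j x) => //= xj.
suff -> : count (leq j) la = 0%N by [].
apply/eqP; rewrite -leqn0 leqNgt -has_count; apply/hasPn => y y_la.
have /allP/(_ _ y_la) : all (geq x) la.
  by apply: order_path_min la_s => u v w /= uv /leq_trans; apply.
by rewrite -ltnNge /= => /leq_ltn_trans; apply.
Qed.

Lemma conj_part_le la j : (conj_part la j <= size la)%N.
Proof. exact: count_size. Qed.

Lemma grass_perm_inj la p i j : is_partition la -> (size la <= p)%N ->
  (0 < i)%N -> (0 < j)%N -> grass_perm la p i = grass_perm la p j -> i = j.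
Proof.
move=> la_p sz; wlog ij : i j / (i < j)%N.
  move=> wl i0 j0 e; case: (ltngtP i j) => // h; first exact: wl.
  by apply/esym; apply: wl.
move=> i0 j0; rewrite /grass_perm.
have mono a c : (0 < a)%N -> (a <= c)%N -> (part la c <= part la a)%N.
  move=> a0 ac; case: (posnP (part la c)) => [->//|pc0].
  rewrite part_conj // (leq_trans ac) // -part_conj //.
  exact: leq_trans ac.
have cmono a c : (a <= c)%N -> (conj_part la c <= conj_part la a)%N.
  by move=> ac; apply: sub_count => x /= /(leq_trans ac).
case: (leqP i p) => ip; case: (leqP j p) => jp.
- have := mono (p.+1 - j)%N (p.+1 - i)%N; lia.
- have := @part_conj la (j - p) (p.+1 - i) la_p.
  have := conj_part_le la (j - p); lia.
- lia.
- have := cmono (i - p)%N (j - p)%N; have := conj_part_le la (i - p); lia.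
Qed.

(* w(lambda) moves only finitely many integers, so that it lies in some S_n. *)
Lemma grass_perm_represented la p : is_partition la -> (size la <= p)%N ->
  exists (N : nat) (w : 'S_N.+1), represents w (grass_perm la p).
Proof.
move=> la_p sz; exists (p + part la 1)%N; set n := (_ + _).+1.
have bnd i : (0 < i <= n)%N -> (0 < grass_perm la p i <= n)%N.
  rewrite /grass_perm /n; case: (leqP i p) => ip; last first.
    by have := conj_part_le la (i - p); lia.
  suff : (part la (p.+1 - i) <= part la 1)%N by lia.
  case: (posnP (part la (p.+1 - i))) => [->//|c0].
  rewrite part_conj //.
  have : (p.+1 - i <= conj_part la (part la (p.+1 - i)))%N.
    by rewrite -part_conj //; lia.
  lia.
have lt_n (i : 'I_n) : ((grass_perm la p i.+1).-1 < n)%N.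
  by have := bnd i.+1; have := ltn_ord i; lia.
have inj : injective (fun i : 'I_n => Ordinal (lt_n i)).
  move=> i j [] e; apply/val_inj => /=.
  apply: succn_inj; apply: (@grass_perm_inj la p) => //.
  have := bnd i.+1; have := bnd j.+1.
  by have := ltn_ord i; have := ltn_ord j; lia.
exists (perm inj); split=> [i|i ni].
  by rewrite permE /=; have := bnd i.+1; have := ltn_ord i; lia.
have ip : (p < i)%N by rewrite /n in ni; lia.
rewrite /grass_perm leqNgt ip /=.
suff -> : conj_part la (i - p) = 0%N by rewrite subn0.
apply/eqP; rewrite -leqn0 leqNgt -part_conj //; last by lia.
by rewrite -ltnNge; rewrite /n in ni; lia.
Qed.

(* Main.v *)
(* Both sides are compared with the bialternant
     A_k(lambda) = det [ (x_i|y)^(lambda_j + k - j) (1 + beta x_i)^(j-1) ],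
   where (x|y)^l = (x (+) y_1) ... (x (+) y_l), through
     G * prod_(i < j) (x_i - x_j) = A_k(lambda).
   For the set-valued tableaux, removing the largest entry k + 1 expresses
   G_lambda(x_1, ..., x_(k+1)) through the G_mu(x_1, ..., x_k) with mu interlacing
   lambda; the bialternants satisfy the same recursion, because column operations
   that clear the row of x_(k+1) turn each entry into a telescoping sum over the
   possible mu_j.
   For the double Grothendieck polynomials, let the code of w be weakly decreasing.
   Then G_w is the product of the (x_j|y)^(code_j), by induction along first ascents
   from the longest element.  Antisymmetrization in x_1, ..., x_k against
   prod (1 + beta x_j)^(j-1) turns each isobaric operator with i < k into
   multiplication by -beta.  So the polynomial of the Grassmannian permutation
   w(lambda), which is symmetric in x_1, ..., x_k, is determined by that of the
   dominant permutation obtained by sorting its first k values decreasingly, and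
   this one antisymmetrizes to A_k(lambda).
   Hence G_(1^m x w(lambda)) = G_lambda(x_1, ..., x_(p+m)|y) for all m, and the
   coefficients on the right stabilize since an entry r of a tableau contributes a
   factor all of whose terms contain x_r or y_(r+c). *)
From HB Require Import structures.
Require Import Defs.
From mathcomp Require Import all_boot all_order all_fingroup all_algebra.
From mathcomp Require Import finmap monalg zify ring.
From Stdlib Require Import ClassicalEpsilon.

Set Implicit Arguments.
Unset Strict Implicit.
Unset Printing Implicit Defensive.

Import GRing.Theory.

Local Open Scope ring_scope.

(** * Bialternants *)

(** Shapes with at most k rows are finite functions so that they can be summed over; extension by 0
    turns them into the sequences on all naturals used elsewhere. *)
Definition ext0 k D (mu : {ffun 'I_k -> 'I_D}) (i : nat) : nat :=
  oapp (fun j => mu j : nat) 0%N (insub i).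

Lemma ext0_ord k D (mu : {ffun 'I_k -> 'I_D}) (i : 'I_k) : ext0 mu i = mu i.
Proof. by rewrite /ext0 valK. Qed.

Lemma ext0_out k D (mu : {ffun 'I_k -> 'I_D}) i : (k <= i)%N -> ext0 mu i = 0%N.
Proof. by move=> ki; rewrite /ext0 insubN // -leqNgt. Qed.

Section Bialternant.
Variables (R : comNzRingType) (b : R) (y : nat -> R).

Definition fsum (u v : R) : R := u + v + b * u * v.

(** A multiple of u plus a multiple of v: this form shows that the coefficients at monomials
    containing neither variable vanish. *)
Lemma fsumM (u v g : R) :
  fsum u v * g = u * (g + b * (v * g)) + v * g.
Proof. by rewrite /fsum; ring. Qed.

Definition rising (p q : nat) (u : R) : R := \prod_(p <= t < q) fsum u (y t.+1).

Lemma rising_cat p q r u : (p <= q)%N -> (q <= r)%N ->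
  rising p r u = rising p q u * rising q r u.
Proof. exact: big_cat_nat. Qed.

Lemma rising_recr p q u : (p <= q)%N ->
  rising p q.+1 u = rising p q u * fsum u (y q.+1).
Proof. exact: big_nat_recr. Qed.

(** Induction on q, splitting off the last factors x (+) y and u (+) y. Their difference is (x - u)
    (1 + b y), and (1 + b u) (1 + b y) = 1 + b (u (+) y) produces the new summand m = q. For q = p +
    1 the left side is just x - u, whence the coefficient 1 at m = p. *)
Lemma rising_exchange p q x u : (p < q)%N ->
  (1 + b * u) * rising p q x - (1 + b * x) * rising p q u =
  (x - u) * \sum_(p <= m < q)
    rising p m x * ((if (p < m)%N then 1 + b * fsum u (y m.+1) else 1)
                    * rising m.+1 q u).
Proof.
elim: q => // q IHq; rewrite ltnS leq_eqVlt => /predU1P[<-|pq].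
  by rewrite big_nat1 ltnn /rising !big_nat1 !big_geq // /fsum; ring.
rewrite big_nat_recr ?(ltnW pq) //= pq.
under eq_big_nat => m /andP[_ mq] do rewrite (rising_recr _ mq) !mulrA.
rewrite -mulr_suml mulrDr mulrA.
under eq_bigr => m _ do rewrite -mulrA.
rewrite -IHq // !(rising_recr _ (ltnW pq)).
have -> : rising q.+1 q.+1 u = 1 by rewrite /rising big_geq.
by rewrite /fsum; ring.
Qed.

Variable x : nat -> R.

Definition bialternant k (lam : nat -> nat) : R :=
  \det (\matrix_(i < k, j < k)
    (rising 0 (lam j + (k.-1 - j)) (x i) * (1 + b * x i) ^+ j)).

(* The contribution of row i to the sum over the positions of the largest entry
   k + 1, when the boxes containing smaller entries form the shape mu. *)
Definition row_weight k (lam mu : nat -> nat) (i : nat) : R :=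
  (if (lam i.+1 < mu i)%N then 1 + b * fsum (x k) (y (mu i + k - i)) else 1)
  * \prod_(mu i <= t < lam i) fsum (x k) (y (t + k.+1 - i)).

Definition interlaces k D (lam : nat -> nat) (mu : {ffun 'I_k -> 'I_D}) :=
  [forall i : 'I_k, (lam i.+1 <= mu i <= lam i)%N].

(** The power of 1 + b x_k on both sides is the determinant of the column operations; it is
    cancelled later, where this element is known to be regular. *)
Lemma bialternant_branching k D (lam : nat -> nat) :
  (forall i, lam i.+1 <= lam i)%N -> (lam 0 < D)%N ->
  (1 + b * x k) ^+ k * bialternant k.+1 lam =
  (1 + b * x k) ^+ k *
   (\prod_(i < k) (x i - x k) *
    \sum_(mu : {ffun 'I_k -> 'I_D} | interlaces lam mu)
       (\prod_(i < k.+1) row_weight k lam (ext0 mu) i)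
        * bialternant k (ext0 mu)).
Proof.
move=> lamS lamD; set u := x k; set v := 1 + b * u.
have lam_le i : (lam i < D)%N.
  by elim: i => // i; apply: leq_ltn_trans.
pose l j := (lam j + (k - j))%N.
rewrite [in LHS]/bialternant; set A := (X in \det X).
(* Column j < k becomes v times column j minus a multiple of column j + 1, chosen so that the row of
   u = x_k vanishes outside its last entry. *)
pose U : 'M[R]_k.+1 := \matrix_(i, j)
  (if i == j then (if (j < k)%N then v else 1)
   else if i == j.+1 :> nat then - rising (l j.+1) (l j) u else 0).
have detU : \det U = v ^+ k.
  rewrite det_trig; last first.
    apply/is_trig_mxP => i j ij; rewrite !mxE -val_eqE /= !ifF //; lia.
  rewrite big_ord_recr /= !mxE eqxx ltnn mulr1.
  rewrite -[in RHS](card_ord k) -prodr_const; apply: eq_bigr => i _.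
  by rewrite !mxE eqxx /= ltn_ord.
have AU i (j : 'I_k) : (A *m U) i (widen_ord (leqnSn k) j) =
    (1 + b * x i) ^+ j * rising 0 (l j.+1) (x i) *
    (v * rising (l j.+1) (l j) (x i)
     - (1 + b * x i) * rising (l j.+1) (l j) u).
  have jk := ltn_ord j.
  pose j0 := widen_ord (leqnSn k) j; pose j1 : 'I_k.+1 := lift ord0 j.
  rewrite mxE (bigD1 j0) // (bigD1 j1) /=; last by rewrite -val_eqE /= /bump; lia.
  rewrite big1 => [|m /andP[m0 m1]]; last first.
    rewrite !mxE (negPf m0) ifF ?mulr0 //.
    by apply: contraNF m1; rewrite -val_eqE /= /bump add1n.
  rewrite !mxE eqxx -val_eqE /= jk /bump /= add1n eqxx gtn_eqF // addr0.
  rewrite -/(l j) -/(l j.+1) (@rising_cat 0 (l j.+1) (l j)) //; last first.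
    by rewrite /l; have := lamS j; lia.
  by rewrite exprS; ring.
have AUmax i : (A *m U) i ord_max =
    (1 + b * x i) ^+ k * rising 0 (lam k) (x i).
  rewrite mxE (bigD1 ord_max) //= big1 ?addr0 => [|m m0]; last first.
    rewrite !mxE (negPf m0) ifF ?mulr0 //=; have := ltn_ord m; lia.
  by rewrite !mxE eqxx ltnn mulr1 subnn addn0 mulrC.
have l_lt (j : 'I_k) : (l j.+1 < l j)%N.
  by rewrite /l; have := lamS j; have := ltn_ord j; lia.
have detAU : \det (A *m U) = \det A * \det U by exact: det_mulmx.
rewrite -detU mulrC -detAU (expand_det_row _ ord_max).
rewrite big_ord_recr /= big1 ?add0r => [|j _]; last first.
  rewrite AU /= -/u.
  by rewrite -/v subrr mulr0 mul0r.
rewrite AUmax /= -/u detU -/v -mulrA; congr (_ * _).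
rewrite /cofactor /= -signr_odd oddD addbb mul1r.
pose B : 'M_k := row' ord_max (col' ord_max (A *m U)); rewrite -/B.
pose g (j m : nat) :=
  (if (lam j.+1 < m)%N then 1 + b * fsum u (y (m + k - j)) else 1)
  * \prod_(m <= t < lam j) fsum u (y (t + k.+1 - j)).
have BE i j : B i j = (x i - u) *
    \sum_(m : 'I_D | (lam j.+1 <= m <= lam j)%N)
      (g j m * (rising 0 (m + (k.-1 - j)) (x i) * (1 + b * x i) ^+ j)).
  have jk := ltn_ord j.
  have e1 : lift ord_max j = widen_ord (leqnSn k) j.
    by apply: val_inj; rewrite /= /bump leqNgt jk.
  have e2 : lift ord_max i = i :> nat by rewrite /= /bump leqNgt ltn_ord.
  rewrite mxE mxE e1 AU e2 rising_exchange // mulrCA; congr (_ * _).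
  rewrite mulr_sumr.
  have -> : l j.+1 = (lam j.+1 + (k.-1 - j))%N by rewrite /l; lia.
  have -> : l j = ((lam j).+1 + (k.-1 - j))%N by rewrite /l; lia.
  (* The summation index is m + c, where m is a candidate for mu_j. The upper bound l j is (lam
     j).+1 + c, so m runs up to lam j inclusive. *)
  set c := (k.-1 - j)%N; rewrite big_addn addnK.
  rewrite (big_nat_widen _ _ D) ?lam_le // (big_nat_widenl _ 0) // big_mkord.
  apply: eq_big => [m|m /andP[/andP[_ h1] h2]]; first by rewrite !ltnS /=; lia.
  rewrite /g ltn_add2r.
  have -> : (m + k - j = (m + c).+1)%N by rewrite /c; lia.
  have -> : rising (m + c).+1 ((lam j).+1 + c) u =
      \prod_(m <= t < lam j) fsum u (y (t + k.+1 - j)).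
    rewrite /rising; have -> : ((m + c).+1 = m + c.+1)%N by lia.
    rewrite big_addn; have -> : ((lam j).+1 + c - c.+1 = lam j)%N by lia.
    by apply: eq_bigr => t _; congr (fsum _ (y _)); rewrite /c; lia.
  rewrite (@rising_cat 0 (lam j.+1 + c) (m + c)); [|lia..].
  ring.
have -> : \det B = \prod_(i < k) (x i - u) *
   \sum_(mu : {ffun 'I_k -> 'I_D} | interlaces lam mu)
       (\prod_(i < k) row_weight k lam (ext0 mu) i) * bialternant k (ext0 mu).
  rewrite /determinant mulr_sumr /bialternant /determinant.
  transitivity (\sum_(s : 'S_k) (-1) ^+ s * (\prod_(i < k) (x i - u) *
     \sum_(mu : {ffun 'I_k -> 'I_D} | interlaces lam mu)
       \prod_(i < k) (row_weight k lam (ext0 mu) i *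
        (rising 0 (mu i + (k.-1 - i)) (x ((s^-1)%g i)) *
           (1 + b * x ((s^-1)%g i)) ^+ i)))).
    apply: eq_bigr => s _; congr (_ * _).
    under eq_bigr => i _ do rewrite BE.
    rewrite big_split /=; congr (_ * _).
    rewrite (reindex_perm (s^-1)%g) /=.
    under eq_bigr => i _ do rewrite permKV.
    (* Distributing the product over the column sums picks one mu_j in each column, that is, one
       interlacing mu. *)
    rewrite (bigA_distr_big_dep (fun (i : 'I_k) (m : 'I_D) =>
       (lam i.+1 <= m <= lam i)%N)) /=.
    apply: eq_big => [mu|mu _]; first by apply: eq_forallb.
    by apply: eq_bigr => i _; rewrite /row_weight ext0_ord.
  under eq_bigr => s _ do rewrite mulrCA mulr_sumr.
  rewrite -[LHS]mulr_sumr exchange_big /= mulr_sumr; apply: eq_bigr => mu _.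
  rewrite !mulr_sumr; apply: eq_bigr => s _.
  rewrite big_split /= [X in _ * X = _]mulrCA.
  congr (_ * (_ * (_ * _))).
  rewrite (reindex_perm s) /=; apply: eq_bigr => i _.
  by rewrite !mxE permK ext0_ord.
rewrite !mulrA [X in X * _ = _]mulrC !mulr_sumr; apply: eq_bigr => mu _.
(* Row k of mu is empty, so its weight is the power (u|y)^(lam k) left over from the last column. *)
rewrite big_ord_recr /= /row_weight ext0_out // ltn0 mul1r.
have -> : \prod_(0 <= t < lam k) fsum (x k) (y (t + k.+1 - k)) =
   rising 0 (lam k) u.
  by apply: eq_bigr => t _; congr (fsum _ (y _)); lia.
ring.
Qed.

End Bialternant.

(** * Isobaric divided differences and permutations *)

(** The transposition of i and i + 1, in an arithmetic form that [lia] can handle. *)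
Definition swap_nat (i j : nat) : nat := (j + (j == i) - (j == i.+1))%N.

Lemma swap_natP i j : [\/ j = i /\ swap_nat i j = i.+1,
  j = i.+1 /\ swap_nat i j = i | [/\ j <> i, j <> i.+1 & swap_nat i j = j]].
Proof.
rewrite /swap_nat; have [->|/eqP ji] := eqVneq j i.
  by constructor 1; rewrite ltn_eqF // addn1 subn0.
have [->|/eqP ji'] := eqVneq j i.+1.
  by constructor 2; rewrite addn0 subn1.
by constructor 3; rewrite addn0 subn0.
Qed.

(** Splits every innermost application by [swap_natP], so that identities between products of
    transpositions become linear arithmetic. *)
Ltac swap_nat_cases := repeat match goal with
  | |- context [swap_nat ?i ?j] => lazymatch j with
    | context [swap_nat _ _] => fail
    | _ => move: (swap_natP i j); generalize (swap_nat i j);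
           let k := fresh "k" in intros k [[? ?]|[? ?]|[? ? ?]]; try (exfalso; lia)
    end
  end.

Lemma swap_natl i : swap_nat i i = i.+1.
Proof. by rewrite /swap_nat; lia. Qed.

Lemma swap_natr i : swap_nat i i.+1 = i.
Proof. by rewrite /swap_nat; lia. Qed.

Lemma swap_nat_id i j : j != i -> j != i.+1 -> swap_nat i j = j.
Proof. by rewrite /swap_nat; lia. Qed.

Lemma swap_natK i : involutive (swap_nat i).
Proof. by move=> j; swap_nat_cases; lia. Qed.

(** * Ring identities behind the relations between isobaric operators *)

Section RingIdentities.
Variable (R : comNzRingType).

(* sf stands for s(f), where s exchanges x and y, and t exchanges y and z.  Both
   sides of the braid relation expand to the same combination of the six images
   of f, up to the denominator (x - y) (x - z) (y - z). *)
Lemma isobaric_braid_l (b x y z f sf tf tsf stf stsf g tg stg h sh k : R) :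
  g * (x - y) = (1 + b * y) * f - (1 + b * x) * sf ->
  tg * (x - z) = (1 + b * z) * tf - (1 + b * x) * tsf ->
  stg * (y - z) = (1 + b * z) * stf - (1 + b * y) * stsf ->
  h * (y - z) = (1 + b * z) * g - (1 + b * y) * tg ->
  sh * (x - z) = (1 + b * z) * g - (1 + b * x) * stg ->
  k * (x - y) = (1 + b * y) * h - (1 + b * x) * sh ->
  k * (x - y) * ((x - z) * (y - z)) =
    (1 + b * z) ^+ 2 * ((1 + b * y) * f - (1 + b * x) * sf)
    - (1 + b * y) ^+ 2 * ((1 + b * z) * tf - (1 + b * x) * tsf)
    + (1 + b * x) ^+ 2 * ((1 + b * z) * stf - (1 + b * y) * stsf).
Proof.
move=> <- <- <- hE shE ->.
have -> : ((1 + b * y) * h - (1 + b * x) * sh) * ((x - z) * (y - z)) =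
  (1 + b * y) * (x - z) * (h * (y - z)) - (1 + b * x) * (y - z) * (sh * (x - z)).
  by ring.
by rewrite hE shE; ring.
Qed.

Lemma isobaric_braid_r (b x y z f sf tf tsf stf tstf g sg tsg h th k : R) :
  g * (y - z) = (1 + b * z) * f - (1 + b * y) * tf ->
  sg * (x - z) = (1 + b * z) * sf - (1 + b * x) * stf ->
  tsg * (x - y) = (1 + b * y) * tsf - (1 + b * x) * tstf ->
  h * (x - y) = (1 + b * y) * g - (1 + b * x) * sg ->
  th * (x - z) = (1 + b * z) * g - (1 + b * x) * tsg ->
  k * (y - z) = (1 + b * z) * h - (1 + b * y) * th ->
  k * (y - z) * ((x - z) * (x - y)) =
    (1 + b * z) ^+ 2 * ((1 + b * y) * f - (1 + b * x) * sf)
    - (1 + b * y) ^+ 2 * ((1 + b * z) * tf - (1 + b * x) * tsf)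
    + (1 + b * x) ^+ 2 * ((1 + b * z) * stf - (1 + b * y) * tstf).
Proof.
move=> gE sgE tsgE hE thE ->.
have -> : ((1 + b * z) * h - (1 + b * y) * th) * ((x - z) * (x - y)) =
  (1 + b * z) * (x - z) * (h * (x - y)) - (1 + b * y) * (x - y) * (th * (x - z)).
  by ring.
rewrite hE thE.
transitivity ((1 + b * z) * (1 + b * y) * (g * (y - z))
   - (1 + b * z) * (1 + b * x) * (sg * (x - z))
   + (1 + b * y) * (1 + b * x) * (tsg * (x - y))); first by ring.
by rewrite gE sgE tsgE; ring.
Qed.

(** The right side is invariant under exchanging the two pairs of variables together with sf and tf,
    so both orders of application agree after clearing denominators. *)
Lemma isobaric_comm_l (b x x' z z' f sf tf stf h sh k : R) :
  h * (z - z') = (1 + b * z') * f - (1 + b * z) * tf ->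
  sh * (z - z') = (1 + b * z') * sf - (1 + b * z) * stf ->
  k * (x - x') = (1 + b * x') * h - (1 + b * x) * sh ->
  k * (x - x') * (z - z') =
    (1 + b * x') * ((1 + b * z') * f - (1 + b * z) * tf)
    - (1 + b * x) * ((1 + b * z') * sf - (1 + b * z) * stf).
Proof. by move=> <- <- ->; ring. Qed.

(** The twisted Leibniz rule: divisibility of f - sf by d passes to products. *)
Lemma divided_difference_mul (d f sf g f' sf' g' : R) :
  g * d = f - sf -> g' * d = f' - sf' ->
  (g * f' + sf * g') * d = f * f' - sf * sf'.
Proof.
move=> e e'; transitivity (g * d * f' + sf * (g' * d)); first by ring.
by rewrite e e'; ring.
Qed.

(** The numerator of the isobaric operator is (1 + b x') (f - sf) - b (x - x') sf, so divisibility
    of f - sf suffices. *)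
Lemma isobaric_quotient (b x x' f sf g : R) :
  g * (x - x') = f - sf ->
  ((1 + b * x') * g - b * sf) * (x - x') = (1 + b * x') * f - (1 + b * x) * sf.
Proof.
move=> e; transitivity ((1 + b * x') * (g * (x - x')) - b * sf * (x - x')).
  by ring.
by rewrite e; ring.
Qed.

End RingIdentities.

(** * Ascents and inversions *)

Section Permutations.
Variable n : nat.
Implicit Types (w : 'S_n) (i j : 'I_n).

Lemma ordSE i : (i.+1 < n)%N -> ordS i = i.+1 :> nat.
Proof. exact: modn_small. Qed.

Lemma simple_refl_val i j : (i.+1 < n)%N -> simple_refl i j = swap_nat i j :> nat.
Proof.
move=> iN; rewrite /simple_refl /swap_nat.
case: tpermP => [->|->|/eqP + /eqP +]; rewrite -?val_eqE /= modn_small //; lia.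
Qed.

Lemma simple_refl_braid i j : j = i.+1 :> nat -> (j.+1 < n)%N ->
  (simple_refl i * simple_refl j * simple_refl i =
   simple_refl j * simple_refl i * simple_refl j)%g.
Proof.
move=> ji jN; apply/permP => x; apply/val_inj; rewrite !permM /=.
by rewrite !simple_refl_val ?ji; [swap_nat_cases|..]; lia.
Qed.

Lemma simple_refl_comm i j : (i.+1 < j)%N -> (j.+1 < n)%N ->
  (simple_refl i * simple_refl j = simple_refl j * simple_refl i)%g.
Proof.
move=> ij jN; apply/permP => x; apply/val_inj; rewrite !permM /=.
by rewrite !simple_refl_val; [swap_nat_cases|..]; lia.
Qed.

Lemma simple_reflM_l i w : (simple_refl i * w)%g i = w (ordS i).
Proof. by rewrite permM tpermL. Qed.

Lemma simple_reflM_r i w : (simple_refl i * w)%g (ordS i) = w i.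
Proof. by rewrite permM tpermR. Qed.

Lemma simple_reflM_id i w j : j != i -> j != ordS i ->
  (simple_refl i * w)%g j = w j.
Proof. by move=> h h'; rewrite permM tpermD // eq_sym. Qed.

Lemma simple_reflK i w : (simple_refl i * (simple_refl i * w))%g = w.
Proof. by rewrite mulgA tperm2 mul1g. Qed.

(** The bound on i excludes the cyclic wrap-around of [ordS]. *)
Definition ascent w i : bool := (i.+1 < n)%N && (w i < w (ordS i))%N.

Definition inversions k w : nat :=
  #|[set ij : 'I_n * 'I_n | (ij.1 < ij.2 < k)%N && (w ij.2 < w ij.1)%N]|.

Lemma perm_length_inversions w : perm_length w = inversions n w.
Proof. by apply: eq_card => -[i j]; rewrite !inE /= ltn_ord andbT. Qed.

(** Moving both positions by the transposition matches the inversions before and after, except that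
    the pair (i, i + 1) is gained; its positions lie below k. *)
Lemma inversions_ascent k w i : ascent w i -> (i.+1 < k)%N ->
  inversions k (simple_refl i * w)%g = (inversions k w).+1.
Proof.
case/andP=> iN wi ik; have Si := (ordSE iN, modn_small iN).
set s := tperm i (ordS i); pose p := (i, ordS i).
pose f (x : 'I_n * 'I_n) := (s x.1, s x.2).
have fK : involutive f by case=> a c; rewrite /f /= !tpermK.
rewrite /inversions (cardsD1 p) inE /= simple_reflM_l simple_reflM_r Si ltnSn ik wi.
rewrite add1n; congr _.+1; rewrite -(card_imset _ (inv_inj fK)) (can2_imset_pre _ fK fK).
apply: eq_card => -[a c]; rewrite !inE /f /= !permM !tpermK -/s.
rewrite xpair_eqE -!val_eqE /=.
rewrite /s; case: tpermP => [->|->|/eqP + /eqP +];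
  case: tpermP => [->|->|/eqP + /eqP +]; rewrite -?val_eqE /= ?Si; lia.
Qed.

Lemma perm_length_ascent w i : ascent w i ->
  perm_length (simple_refl i * w)%g = (perm_length w).+1.
Proof.
move=> wi; rewrite !perm_length_inversions inversions_ascent //.
by case/andP: wi.
Qed.

Lemma ascentP w i : (i.+1 < n)%N ->
  (perm_length w < perm_length (simple_refl i * w)%g)%N = ascent w i.
Proof.
move=> iN; apply/idP/idP => [|wi]; last by rewrite perm_length_ascent.
apply: contraTT => wi; have := @perm_length_ascent (simple_refl i * w)%g i.
rewrite simple_reflK => -> //; first by rewrite -leqNgt.
rewrite /ascent iN simple_reflM_l simple_reflM_r ltn_neqAle /=.
rewrite /ascent iN /= -leqNgt in wi; rewrite wi andbT.
apply/eqP => /val_inj /perm_inj /(congr1 val) /=; rewrite modn_small //; lia.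
Qed.

Lemma perm_length_le w : (perm_length w <= n * n)%N.
Proof.
by rewrite (leq_trans (max_card _)) // card_prod card_ord.
Qed.

Lemma longest_no_ascent i : ascent (longest n) i = false.
Proof.
rewrite /ascent; case: leqP => //= iN; rewrite !permE /= modn_small //.
by apply/negbTE; lia.
Qed.

Lemma no_ascent_decreasing k w i j : (k <= n)%N ->
  (forall i, (i.+1 < k)%N -> ascent w i = false) -> (i <= j < k)%N ->
  (w j + (j - i) <= w i)%N.
Proof.
move=> kn wk; case: j => j jn /= /andP[]; elim: j jn => [|j IHj] jn.
  rewrite leqn0 => /eqP i0 _; rewrite sub0n addn0.
  by have -> : i = Ordinal jn by apply/val_inj.
rewrite leq_eqVlt => /predU1P[ij _|].
  have -> : i = Ordinal jn by apply/val_inj.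
  by rewrite subnn addn0.
rewrite ltnS => ij jk; have jn' := ltnW jn.
have {IHj} := IHj jn' ij (ltnW jk).
have := wk (Ordinal jn') jk; rewrite /ascent /= jn /=.
have -> : ordS (Ordinal jn') = Ordinal jn by apply/val_inj; rewrite /= modn_small.
have /eqP : w (Ordinal jn') <> w (Ordinal jn).
  by move/perm_inj/(congr1 val) => /=; lia.
by rewrite -val_eqE /=; lia.
Qed.

Lemma no_ascent_longest w : (forall i, ascent w i = false) -> w = longest n.
Proof.
move=> w0; apply/permP => i; rewrite permE; apply/val_inj => /=.
have in_ := ltn_ord i; have n0 : (0 < n)%N by lia.
have nn : (n.-1 < n)%N by lia.
have := @no_ascent_decreasing n w (Ordinal n0) i (leqnn n) (fun i _ => w0 i).
have := @no_ascent_decreasing n w i (Ordinal nn) (leqnn n) (fun i _ => w0 i).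
rewrite /= ltn_ord nn; have := ltn_ord (w (Ordinal n0)).
lia.
Qed.

End Permutations.

(** * Construction of a family by descent from the longest permutation *)

Section Existence.
Variables (T : Type) (iso : nat -> T -> T) (top : T).
Hypothesis iso_braid : forall i f,
  iso i (iso i.+1 (iso i f)) = iso i.+1 (iso i (iso i.+1 f)).
Hypothesis iso_comm : forall i j f, (i.+1 < j)%N ->
  iso i (iso j f) = iso j (iso i f).
Variable n : nat.
Implicit Types (w : 'S_n) (i j : 'I_n).

(** The counter d makes the recursion structural; since n * n bounds the length, starting from n * n
    minus the length leaves enough steps. *)
Fixpoint descend d w : T :=
  if d is d'.+1 then
    if [pick i | ascent w i] is Some i then iso i.+1 (descend d' (simple_refl i * w)%g)
    else top
  else top.

Definition descend_from_longest w := descend (n * n - perm_length w) w.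

(** Independence of the chosen ascent is shown by induction on the colength. Two ascents of w
    commute or are adjacent; climbing through both closes a square or a hexagon of longer
    permutations, where the induction hypothesis and the commutation or braid relation apply. *)
Local Notation F := descend_from_longest.

Lemma descend_ascent w i : ascent w i -> F w = iso i.+1 (F (simple_refl i * w)%g).
Proof.
move: {2}(n * n - perm_length w)%N (leqnn (n * n - perm_length w)) => d.
elim: d w i => [|d IHd] w i wd wi.
  have := perm_length_le (simple_refl i * w)%g; rewrite perm_length_ascent //; lia.
have len j : ascent w j ->
    (n * n - perm_length w = (n * n - perm_length (simple_refl j * w)%g).+1)%N.
  move=> wj; have := perm_length_le (simple_refl j * w)%g.
  rewrite perm_length_ascent //; lia.
have IH j v : (perm_length w < perm_length v)%N -> ascent v j ->
    F v = iso j.+1 (F (simple_refl j * v)%g).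
  by move=> lv vj; apply: IHd => //; have := perm_length_le v; lia.
have up j v : ascent v j -> (perm_length w <= perm_length v)%N ->
    (perm_length w < perm_length (simple_refl j * v)%g)%N.
  by move=> vj; rewrite perm_length_ascent.
(* The recursion uses the ascent found by [pick], so it remains to compare two ascents. *)
suff choice i1 i2 : (i1 < i2)%N -> ascent w i1 -> ascent w i2 ->
    iso i1.+1 (F (simple_refl i1 * w)%g) = iso i2.+1 (F (simple_refl i2 * w)%g).
  rewrite {1}/F /descend_from_longest (len i wi) /=.
  case: pickP => [j wj|/(_ i)]; last by rewrite wi.
  rewrite [descend _ (simple_refl j * w)%g](_ : _ = F (simple_refl j * w)%g).
    2: by rewrite /F /descend_from_longest !perm_length_ascent.
  have [ij|ij|/val_inj->//] := ltngtP i j.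
    exact/esym/(choice _ _ ij).
  exact: (choice _ _ ij).
move=> i12 w1 w2; have [N1 lt1] := andP w1; have [N2 lt2] := andP w2.
set s1 := simple_refl i1; set s2 := simple_refl i2.
have S1 := ordSE N1; have S2 := ordSE N2.
have l1 := up _ _ w1 (leqnn _); have l2 := up _ _ w2 (leqnn _).
have neq (a c : 'I_n) : a != c :> nat -> a != c by [].
have [far|near] := ltnP i1.+1 i2.
  have a12 : ascent (s1 * w)%g i2.
    by rewrite /ascent N2 !simple_reflM_id //; apply: neq; rewrite ?S1 ?S2; lia.
  have a21 : ascent (s2 * w)%g i1.
    by rewrite /ascent N1 !simple_reflM_id //; apply: neq; rewrite ?S1 ?S2; lia.
  rewrite (IH _ _ l1 a12) (IH _ _ l2 a21) iso_comm //; congr (iso _ (iso _ (F _))).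
  by rewrite !mulgA -(simple_refl_comm far N2).
have i2S : i2 = i1.+1 :> nat by apply/eqP; rewrite eqn_leq near.
have i2E : ordS i1 = i2 by apply/val_inj; rewrite /= i2S modn_small.
set i3 := ordS i2 in S2 lt2; rewrite i2E in lt1.
have [i21 i31 i32] : [/\ i2 != i1, i3 != i1 & i3 != i2].
  by split; apply: neq; rewrite ?S2; lia.
have s1E v : ((s1 * v)%g i1 = v i2) * ((s1 * v)%g i2 = v i1) * ((s1 * v)%g i3 = v i3).
  by rewrite -i2E simple_reflM_l simple_reflM_r simple_reflM_id ?i2E.
have s2E v : ((s2 * v)%g i1 = v i1) * ((s2 * v)%g i2 = v i3) * ((s2 * v)%g i3 = v i2).
  by rewrite simple_reflM_l simple_reflM_r simple_reflM_id // 1?eq_sym.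
have asc1 v : ascent v i1 = (v i1 < v i2)%N by rewrite /ascent N1 i2E.
have asc2 v : ascent v i2 = (v i2 < v i3)%N by rewrite /ascent N2.
have lt13 := ltn_trans lt1 lt2.
have a12 : ascent (s1 * w)%g i2 by rewrite asc2 !s1E.
have a21 : ascent (s2 * w)%g i1 by rewrite asc1 !s2E.
have l12 := up _ _ a12 (ltnW l1); have l21 := up _ _ a21 (ltnW l2).
have a121 : ascent (s2 * (s1 * w))%g i1 by rewrite asc1 !(s1E, s2E).
have a212 : ascent (s1 * (s2 * w))%g i2 by rewrite asc2 !(s1E, s2E).
rewrite (IH _ _ l1 a12) (IH _ _ l12 a121) (IH _ _ l2 a21) (IH _ _ l21 a212).
by rewrite i2S iso_braid !mulgA (simple_refl_braid i2S N2).
Qed.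

Lemma descend_longest : F (longest n) = top.
Proof.
rewrite /F /descend_from_longest; case: (_ - _)%N => //= d.
by case: pickP => // i; rewrite longest_no_ascent.
Qed.

End Existence.

Lemma card_ord_between n a c : (c <= n)%N ->
  (\sum_(i < n) (a <= i < c)%N = c - a)%N.
Proof.
move=> cn; rewrite -(big_mkord predT (fun i => nat_of_bool (a <= i < c)%N)).
rewrite (big_cat_nat (n := c)) //= addnC big1_seq ?add0n => [|i]; last first.
  by rewrite mem_index_iota; lia.
have [ac|/ltnW ca] := leqP a c; last first.
  rewrite big1_seq => [|i]; first by lia.
  by rewrite mem_index_iota; lia.
rewrite (big_cat_nat (n := a)) //= big1_seq ?add0n => [|i]; last first.
  by rewrite mem_index_iota; lia.
rewrite (eq_big_nat _ _ (F2 := fun=> 1%N)) => [|i ->] //.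
by rewrite sum_nat_const_nat muln1.
Qed.

(** * Lehmer codes and dominant permutations *)

Section Code.
Variable n : nat.
Implicit Types (w : 'S_n) (i j : 'I_n).

Definition code w j : nat := (\sum_(i < n) ((j < i) && (w i < w j)))%N.

(* Permutations with a weakly decreasing code are the dominant ones. *)
Definition dominant w := forall i : 'I_n, (i.+1 < n)%N ->
  (code w (ordS i) <= code w i)%N.

Lemma code_longest j : code (longest n) j = (n.-1 - j)%N.
Proof.
rewrite /code -[RHS](_ : (n - j.+1)%N = _); last by lia.
rewrite -(card_ord_between j.+1 (leqnn n)); apply: eq_bigr => i _.
rewrite !permE /= ltn_ord; have := ltn_ord i; have := ltn_ord j; lia.
Qed.

Lemma code_no_inversion w j : (forall i, (j < i)%N -> (w j < w i)%N) -> code w j = 0%N.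
Proof.
move=> wj; apply: big1 => i _; case: ltnP => //= /wj /ltnW.
by rewrite leqNgt => /negbTE->.
Qed.

(** Values start at 0, so there are [w j] values smaller than [w j], and all of them sit to the
    right of position j. *)
Lemma code_eq_val w j : (forall i, (i < j)%N -> (w j < w i)%N) -> code w j = w j.
Proof.
move=> wj; transitivity (\sum_(i < n) (0 <= w i < w j))%N.
  apply: eq_bigr => i _; rewrite leq0n /=; case: ltngtP => //= [/wj|/val_inj->].
    by move/ltnW; rewrite leqNgt => /negbTE->.
  by rewrite ltnn.
rewrite -[RHS]subn0 -(card_ord_between 0 (ltnW (ltn_ord (w j)))).
by rewrite [RHS](reindex_perm w).
Qed.

Lemma code_descent w i j : (i < j)%N -> (w j < w i)%N -> (code w j < code w i)%N.
Proof.
move=> ij wij; rewrite /code (bigD1 j) //= ltnn add0n [X in (_ < X)%N](bigD1 j) //=.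
rewrite ij wij add1n ltnS; apply: leq_sum => a _.
by case: ltnP => //= ja; case: ltnP => //= wa; rewrite (ltn_trans ij) ?(ltn_trans wa).
Qed.

Section Ascent.
Variables (w : 'S_n) (i : 'I_n).
Hypothesis wi : ascent w i.
Let iN : (i.+1 < n)%N. Proof. by case/andP: wi. Qed.
Let lt : (w i < w (ordS i))%N. Proof. by case/andP: wi. Qed.
Let sw := (simple_refl i * w)%g.

Lemma code_ascent_le : (code w i <= code w (ordS i))%N.
Proof.
rewrite /code (bigD1 (ordS i)) //= [(w (ordS i) < w i)%N]ltnNge (ltnW lt) andbF add0n.
rewrite [X in (_ <= X)%N](bigD1 (ordS i)) //= ltnn add0n.
apply: leq_sum => a aS; have : a != i.+1 :> nat.
  by move: aS; rewrite -val_eqE /= modn_small.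
case: (ltnP (w a) (w i)) => wa; rewrite ?andbF //= => ai.
rewrite (ltn_trans wa lt) modn_small //; lia.
Qed.

Let codeE j : code sw j =
  (\sum_(a < n) ((j < simple_refl i a) && (w a < sw j)))%N.
Proof.
rewrite /code (reindex_perm (simple_refl i)); apply: eq_bigr => a _.
by have -> : sw (simple_refl i a) = w a by rewrite permM tpermK.
Qed.

(** At an ascent the transposition exchanges two neighbouring entries of the code and adds one to
    the left one, since the smaller value now stands to the right of the larger. *)
Lemma code_simple_refl_l : code sw i = (code w (ordS i)).+1.
Proof.
rewrite codeE /sw simple_reflM_l (bigD1 i) //= simple_refl_val // swap_natl ltnSn lt.
rewrite add1n /code; congr _.+1.
rewrite [RHS](bigD1 i) //= modn_small // [(i.+1 < i)%N]ltnNge leqnSn add0n.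
apply: eq_bigr => a ai; rewrite simple_refl_val //.
by congr (_ && _ : nat); move: ai; rewrite -val_eqE /=; swap_nat_cases; lia.
Qed.

Lemma code_simple_refl_r : code sw (ordS i) = code w i.
Proof.
rewrite codeE /sw simple_reflM_r; apply: eq_bigr => a _; rewrite simple_refl_val //.
rewrite /= modn_small //; case: (ltnP (w a) (w i)) => wa; rewrite ?andbF ?andbT //.
have /eqP : a <> ordS i by move=> e; rewrite e ltnNge ltnW in wa.
by rewrite -val_eqE /= modn_small // => ?; congr nat_of_bool; swap_nat_cases; lia.
Qed.

Lemma code_simple_refl_id j : j != i -> j != ordS i -> code sw j = code w j.
Proof.
move=> ji jS; rewrite codeE /sw simple_reflM_id //; apply: eq_bigr => a _.
rewrite simple_refl_val //; congr (_ && _ : nat).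
move: ji jS; rewrite -!val_eqE /= modn_small //; swap_nat_cases; lia.
Qed.

End Ascent.

(** An ascent makes the code weakly increase, dominance makes it weakly decrease, so its entries
    there are c, c and become c + 1, c. Dominance survives at the preceding position because that is
    a descent, which makes its code entry larger than c. *)
Lemma dominant_first_ascent w i : dominant w -> ascent w i ->
  (forall j, (j < i)%N -> ascent w j = false) ->
  code w (ordS i) = code w i /\ dominant (simple_refl i * w)%g.
Proof.
move=> wd wi first; have iN : (i.+1 < n)%N by case/andP: wi.
have e : code w (ordS i) = code w i.
  by apply/eqP; rewrite eqn_leq code_ascent_le // wd.
split=> // j jN; have Sj := ordSE jN; have Si := ordSE iN.
have [->|ji] := eqVneq j i.
  by rewrite code_simple_refl_l // code_simple_refl_r // ltnW // e.
have [jS|jS] := eqVneq j (ordS i).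
  rewrite jS code_simple_refl_r // -e -jS code_simple_refl_id ?wd //.
    by rewrite -val_eqE /= modn_small // jS /= modn_small //; lia.
  by rewrite -val_eqE /= modn_small // jS /= modn_small //; lia.
rewrite (code_simple_refl_id wi ji jS).
have [Sji|Sji] := eqVneq (ordS j) i.
  have iE : i = j.+1 :> nat by rewrite -Sj Sji.
  have ji' : (j < i)%N by rewrite iE.
  rewrite Sji code_simple_refl_l // e; apply: code_descent => //.
  have := first j ji'; rewrite /ascent jN Sji => /negbT; rewrite -leqNgt.
  by rewrite leq_eqVlt => /predU1P[/val_inj/perm_inj/(congr1 val)|//] /=; lia.
rewrite code_simple_refl_id //; first exact: wd.
by rewrite -val_eqE /= !modn_small //; move: ji; rewrite -val_eqE /=; lia.
Qed.

End Code.

(** * Isobaric operators over a ring with an action on the indices of the x's *)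

Section Isobaric.

Variables (R : comNzRingType) (b : R) (X Y : nat -> R).
Variable act : (nat -> nat) -> {rmorphism R -> R}.
Hypothesis act_b : forall r, act r b = b.
Hypothesis act_X : forall r j, act r (X j) = X (r j).
Hypothesis act_Y : forall r j, act r (Y j) = Y j.
Hypothesis act_comp : forall r r' f, act r (act r' f) = act (r \o r') f.
Hypothesis eq_act : forall r r', r =1 r' -> act r =1 act r'.
Hypothesis act_id : forall f, act id f = f.
Hypothesis X_lreg : forall i j, i != j -> GRing.lreg (X i - X j).
Variable iso : nat -> R -> R.

Local Notation sw i := (act (swap_nat i)).

Hypothesis isoP : forall i f, iso i f * (X i - X i.+1) =
  (1 + b * X i.+1) * f - (1 + b * X i) * sw i f.

Lemma act_Xl i : sw i (X i) = X i.+1.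
Proof. by rewrite act_X swap_natl. Qed.

Lemma act_Xr i : sw i (X i.+1) = X i.
Proof. by rewrite act_X swap_natr. Qed.

Lemma act_X_id i j : j != i -> j != i.+1 -> sw i (X j) = X j.
Proof. by move=> h h'; rewrite act_X swap_nat_id. Qed.

Let act_simp := (act_b, act_Xl, act_Xr, act_Y).
Let morph_simp := (rmorphM, rmorphB, rmorphD, rmorph1).

Lemma swK i : involutive (sw i).
Proof.
by move=> f; rewrite act_comp -[RHS]act_id; apply: eq_act => j /=; rewrite swap_natK.
Qed.

Lemma sw_braid i f : sw i (sw i.+1 (sw i f)) = sw i.+1 (sw i (sw i.+1 f)).
Proof. by rewrite !act_comp; apply: eq_act => j /=; swap_nat_cases; lia. Qed.

Lemma sw_comm i j f : (i.+1 < j)%N -> sw i (sw j f) = sw j (sw i f).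
Proof.
by move=> ij; rewrite !act_comp; apply: eq_act => k /=; swap_nat_cases; lia.
Qed.

Lemma XS_lreg i : GRing.lreg (X i - X i.+1).
Proof. by apply: X_lreg; lia. Qed.

Lemma iso_unique i f g : g * (X i - X i.+1) =
  (1 + b * X i.+1) * f - (1 + b * X i) * sw i f -> iso i f = g.
Proof. by move=> h; apply: (@XS_lreg i); rewrite mulrC isoP -h mulrC. Qed.

(** The exchange negates both the numerator and the denominator. *)
Lemma sw_iso i f : sw i (iso i f) = iso i f.
Proof.
apply/esym/iso_unique.
have := congr1 (sw i) (isoP i f).
rewrite !morph_simp /= !act_simp swK.
by move=> e; rewrite -[X i - _]opprB mulrN e opprB.
Qed.

Lemma isoMl i h f : sw i h = h -> iso i (h * f) = h * iso i f.
Proof.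
by move=> sh; apply: iso_unique; rewrite -mulrA isoP rmorphM /= sh; ring.
Qed.

Lemma iso_fsum i c : iso i (fsum b (X i) (Y c)) = 1.
Proof. by apply: iso_unique; rewrite /fsum !morph_simp /= !act_simp; ring. Qed.

(** Applying s and t to the defining equations supplies the hypotheses of the ring identities. The
    equality holds after multiplication by the three differences of variables, whose product is
    regular. *)
Lemma iso_braid i f :
  iso i (iso i.+1 (iso i f)) = iso i.+1 (iso i (iso i.+1 f)).
Proof.
set s := sw i; set t := sw i.+1.
have sP g := isoP i g; have tP g := isoP i.+1 g; rewrite -/s -/t in sP tP.
have sx : s (X i.+2) = X i.+2 by apply: act_X_id; lia.
have tx : t (X i) = X i by apply: act_X_id; lia.
have [sl sr sb] : [/\ s (X i) = X i.+1, s (X i.+1) = X i & s b = b].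
  by rewrite /s !act_simp.
have [tl tr tb] : [/\ t (X i.+1) = X i.+2, t (X i.+2) = X i.+1 & t b = b].
  by rewrite /t !act_simp.
have tsP g : t (iso i g) * (X i - X i.+2) =
    (1 + b * X i.+2) * t g - (1 + b * X i) * t (s g).
  by have := congr1 t (sP g); rewrite !morph_simp tx tl tb.
have stP g : s (iso i.+1 g) * (X i - X i.+2) =
    (1 + b * X i.+2) * s g - (1 + b * X i) * s (t g).
  by have := congr1 s (tP g); rewrite !morph_simp sx sr sb.
have stsP g : s (t (iso i g)) * (X i.+1 - X i.+2) =
    (1 + b * X i.+2) * s (t g) - (1 + b * X i.+1) * s (t (s g)).
  by have := congr1 s (tsP g); rewrite !morph_simp sx sl sb.
have tstP g : t (s (iso i.+1 g)) * (X i - X i.+1) =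
    (1 + b * X i.+1) * t (s g) - (1 + b * X i) * t (s (t g)).
  by have := congr1 t (stP g); rewrite !morph_simp tx tr tb.
have sh := stP (iso i f); rewrite [s (iso i f)]sw_iso in sh.
have th := tsP (iso i.+1 f); rewrite [t (iso i.+1 f)]sw_iso in th.
have el := isobaric_braid_l (sP f) (tsP f) (stsP f) (tP _) sh (sP _).
have er := isobaric_braid_r (tP f) (stP f) (tstP f) (sP _) th (tP _).
have reg : GRing.lreg ((X i - X i.+1) * ((X i - X i.+2) * (X i.+1 - X i.+2))).
  by apply: lregM; [|apply: lregM]; apply: X_lreg; lia.
apply: reg; rewrite [LHS]mulrC [LHS]mulrA el [s (t (s f))]sw_braid -er; ring.
Qed.

Lemma iso_comm i j f : (i.+1 < j)%N -> iso i (iso j f) = iso j (iso i f).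
Proof.
move=> ij; set s := sw i; set t := sw j.
have sP g := isoP i g; have tP g := isoP j g; rewrite -/s -/t in sP tP.
have [s1 s2] : s (X j) = X j /\ s (X j.+1) = X j.+1.
  by rewrite /s !act_X_id //; lia.
have [t1 t2] : t (X i) = X i /\ t (X i.+1) = X i.+1.
  by rewrite /t !act_X_id //; lia.
have stP g : s (iso j g) * (X j - X j.+1) =
    (1 + b * X j.+1) * s g - (1 + b * X j) * s (t g).
  by have := congr1 s (tP g); rewrite !morph_simp s1 s2 act_b.
have tsP g : t (iso i g) * (X i - X i.+1) =
    (1 + b * X i.+1) * t g - (1 + b * X i) * t (s g).
  by have := congr1 t (sP g); rewrite !morph_simp t1 t2 act_b.
have el := isobaric_comm_l (tP f) (stP f) (sP _).
have er := isobaric_comm_l (sP f) (tsP f) (tP _).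
have reg : GRing.lreg ((X i - X i.+1) * (X j - X j.+1)).
  by apply: lregM; apply: XS_lreg.
apply: reg; rewrite [LHS]mulrC [LHS]mulrA el [s (t f)]sw_comm //.
rewrite [RHS]mulrC [X in _ = _ * X]mulrC [RHS]mulrA er; ring.
Qed.


Lemma act_rising r p q u : act r (rising b Y p q u) = rising b Y p q (act r u).
Proof.
rewrite rmorph_prod; apply: eq_bigr => t _.
by rewrite /fsum !morph_simp act_b act_Y.
Qed.

(** * Families satisfying the recursion, and their dominant members *)

Section Family.
Variables (n : nat) (F : 'S_n -> R).
Hypothesis F_longest :
  F (longest n) = \prod_(j < n) rising b Y 0 (n.-1 - j) (X j.+1).
Hypothesis F_ascent : forall w i, ascent w i ->
  F w = iso i.+1 (F (simple_refl i * w)%g).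

(** Induction on the colength along first ascents. There the code c, c becomes c + 1, c, so the
    product for the longer permutation is symmetric in the two variables apart from one factor x (+)
    y_(c+1), which the operator sends to 1. *)
Lemma dominant_formula w : dominant w ->
  F w = \prod_(j < n) rising b Y 0 (code w j) (X j.+1).
Proof.
move: {2}(n * n - perm_length w)%N (leqnn (n * n - perm_length w)) => d.
elim: d w => [|d IHd] w wd dom; case: (pickP (ascent w)) => [i0 w0|none];
  try by rewrite (no_ascent_longest none) F_longest;
         apply: eq_bigr => j _; rewrite code_longest.
  have := perm_length_le (simple_refl i0 * w)%g; rewrite perm_length_ascent //; lia.
case: (arg_minnP (fun i : 'I_n => i : nat) w0) => i wi imin {i0 w0}.
have [e sdom] : code w (ordS i) = code w i /\ dominant (simple_refl i * w)%g.
  apply: dominant_first_ascent => // j ji; apply/negbTE.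
  by apply: contraL ji => /imin; rewrite -leqNgt.
have iN : (i.+1 < n)%N by case/andP: wi.
rewrite (F_ascent wi) IHd //; last first.
  have := perm_length_le (simple_refl i * w)%g; rewrite perm_length_ascent //; lia.
have Si : ordS i != i by rewrite -val_eqE /= modn_small //; lia.
rewrite (bigD1 i) //= (bigD1 (ordS i)) //= code_simple_refl_l // code_simple_refl_r //.
rewrite [RHS](bigD1 i) //= [in RHS](bigD1 (ordS i)) //= e modn_small //.
rewrite (eq_bigr (fun j : 'I_n => rising b Y 0 (code w j) (X j.+1))); last first.
  by move=> j /andP[ji jS]; rewrite code_simple_refl_id.
rewrite rising_recr //; set c := code w i; set P := \prod_(_ < n | _) _.
set r := rising b Y 0 c.
have -> : r (X i.+1) * fsum b (X i.+1) (Y c.+1) * (r (X i.+2) * P) =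
  (r (X i.+1) * (r (X i.+2) * P)) * fsum b (X i.+1) (Y c.+1) by ring.
rewrite isoMl ?iso_fsum ?mulr1 // !rmorphM /= !act_rising act_Xl act_Xr.
have -> : sw i.+1 P = P; last by rewrite /r; ring.
rewrite rmorph_prod; apply: eq_bigr => j /andP[ji jS].
rewrite act_rising act_X_id //; move: ji jS; rewrite -!val_eqE /= ?modn_small //; lia.
Qed.

(** * Antisymmetrization in the first k variables *)

Section Antisymmetrization.
Variable k : nat.
Hypothesis kn : (k <= n)%N.

(* Indices of variables start at 1, elements of 'I_k at 0. *)
Definition shift_index (s : 'S_k) (j : nat) : nat :=
  if j is j'.+1 then oapp (fun i => (s i).+1) j (insub j' : option 'I_k) else 0.

Lemma shift_index_ord s (i : 'I_k) : shift_index s i.+1 = (s i).+1.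
Proof. by rewrite /shift_index valK. Qed.

Lemma shift_index_out s j : (k < j)%N || (j == 0%N) -> shift_index s j = j.
Proof.
case: j => //= j; rewrite orbF => kj.
by rewrite insubN // -leqNgt.
Qed.

Lemma shift_index_swap s (i : 'I_k) : (i.+1 < k)%N ->
  shift_index s \o swap_nat i.+1 =1 shift_index (simple_refl i * s)%g.
Proof.
move=> ik j /=; have [jk|jk] := boolP ((k < j)%N || (j == 0%N)).
  rewrite shift_index_out ?shift_index_out //; swap_nat_cases; lia.
have jk' : (j.-1 < k)%N by lia.
have -> : j = (Ordinal jk').+1 :> nat by rewrite /=; lia.
rewrite shift_index_ord permM -shift_index_ord simple_refl_val //.
congr (shift_index s _); swap_nat_cases; lia.
Qed.

Definition antisym f : R := \sum_(s : 'S_k) (-1) ^+ s * act (shift_index s) f.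

Lemma antisymD f g : antisym (f + g) = antisym f + antisym g.
Proof. by rewrite -big_split; apply: eq_bigr => s _; rewrite rmorphD mulrDr. Qed.

Lemma antisymN f : antisym (- f) = - antisym f.
Proof. by rewrite -sumrN; apply: eq_bigr => s _; rewrite rmorphN mulrN. Qed.

Lemma antisym_bM f : antisym (b * f) = b * antisym f.
Proof.
by rewrite mulr_sumr; apply: eq_bigr => s _; rewrite rmorphM act_b mulrCA.
Qed.

Lemma antisym_sw (i : 'I_k) f : (i.+1 < k)%N -> antisym (sw i.+1 f) = - antisym f.
Proof.
move=> ik; rewrite /antisym -sumrN.
rewrite [RHS](reindex_inj (mulgI (simple_refl i))); apply: eq_bigr => s _.
rewrite act_comp (eq_act (shift_index_swap s ik)) odd_permM odd_tperm.
have -> : i != ordS i by rewrite -val_eqE /= modn_small //; lia.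
by case: (odd_perm s); rewrite /= ?mulN1r ?mul1r ?opprK ?expr1 ?expr0 ?mul1r ?mulN1r.
Qed.

(** The diagonal powers of 1 + b x in the bialternant; antisymmetrizing against them produces the
    determinant. *)
Definition beta_weight : R := \prod_(j < k) (1 + b * X j.+1) ^+ j.

Definition antisym_beta f : R := antisym (beta_weight * f).

Hypothesis two_torsion_free : forall f : R, f *+ 2 = 0 -> f = 0.

(* If g is symmetric in X_i, X_(i+1), then so is the beta weight times g up to a
   factor 1 + b X_(i+1), and 1 + b X_(i+1) antisymmetrizes to a multiple of
   X_i - X_(i+1), the denominator of the isobaric operator. *)
Lemma antisym_iso (i : 'I_k) f : (i.+1 < k)%N ->
  antisym_beta (iso i.+1 f) = - (b * antisym_beta f).
Proof.
move=> ik; have Si : ordS i != i by rewrite -val_eqE /= modn_small //; lia.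
have [h hE sh] : exists2 h, beta_weight = h * (1 + b * X i.+2) & sw i.+1 h = h.
  exists ((1 + b * X i.+1) ^+ i * (1 + b * X i.+2) ^+ i *
    \prod_(j < k | (j != i) && (j != ordS i)) (1 + b * X j.+1) ^+ j).
    rewrite /beta_weight (bigD1 i) //= (bigD1 (ordS i)) //= modn_small //.
    by rewrite exprS; ring.
  rewrite !rmorphM /= !rmorphXn /= !morph_simp !act_simp rmorph_prod.
  congr (_ * _); first by rewrite mulrC.
  apply: eq_bigr => j; rewrite -!val_eqE /= modn_small // => /andP[ji jS].
  by rewrite rmorphXn !morph_simp act_b act_X_id //; lia.
set g := iso i.+1 f; set W := beta_weight.
(* The left side is -(b h) times g times the difference of variables, and g times that difference is
   the numerator of the isobaric operator. *)
have e : W * g - sw i.+1 (W * g) = - (b * (W * f - sw i.+1 (W * f))).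
  rewrite /W hE !morph_simp /= sh !act_simp sw_iso -/g.
  have := isoP i.+1 f; rewrite -/g => gE.
  transitivity (- (b * h) * (g * (X i.+1 - X i.+2))); first by ring.
  by rewrite gE; ring.
(* Antisymmetrizing [e] doubles both sides, as the exchanged terms carry the opposite sign; hence
   the cancellation of 2. *)
apply/eqP; rewrite -subr_eq0; apply/eqP/two_torsion_free.
have := congr1 antisym e.
rewrite antisymN antisym_bM !antisymD !antisymN !antisym_sw // !opprK.
rewrite /antisym_beta -/W => e2; rewrite mulr2n addrACA e2; ring.
Qed.

(** Climbing through ascents shows that every permutation acts on f like the longest one, hence like
    the identity. *)
Lemma sw_symmetric f : (forall i : 'I_k, (i.+1 < k)%N -> sw i.+1 f = f) ->
  forall s, act (shift_index s) f = f.
Proof.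
move=> sym.
have step s (i : 'I_k) : (i.+1 < k)%N ->
    act (shift_index (simple_refl i * s)%g) f = act (shift_index s) f.
  by move=> ik; rewrite -(eq_act (shift_index_swap s ik)) -act_comp sym.
have top s : act (shift_index s) f = act (shift_index (longest k)) f.
  move: {2}(k * k - perm_length s)%N (leqnn (k * k - perm_length s)) => d.
  elim: d s => [|d IHd] s sd; case: (pickP (ascent s)) => [i si|none].
  - have := perm_length_le (simple_refl i * s)%g; rewrite perm_length_ascent //; lia.
  - by rewrite (no_ascent_longest none).
  - rewrite -(step s i); last by case/andP: si.
    apply: IHd; have := perm_length_le (simple_refl i * s)%g.
    by rewrite perm_length_ascent //; lia.
  - by rewrite (no_ascent_longest none).
move=> s; rewrite top -(top 1%g) -[RHS]act_id; apply: eq_act => j.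
have [jk|jk] := boolP ((k < j)%N || (j == 0%N)); first exact: shift_index_out.
have jk' : (j.-1 < k)%N by lia.
have -> : j = (Ordinal jk').+1 :> nat by rewrite /=; lia.
by rewrite shift_index_ord perm1.
Qed.

(** The Leibniz expansion of the transposed determinant. *)
Lemma antisym_beta_rising l :
  antisym_beta (\prod_(j < k) rising b Y 0 (l j) (X j.+1)) =
  \det (\matrix_(i < k, j < k) (rising b Y 0 (l j) (X i.+1) * (1 + b * X i.+1) ^+ j)).
Proof.
rewrite -det_tr; apply: eq_bigr => s _; congr (_ * _).
rewrite /beta_weight -big_split rmorph_prod; apply: eq_bigr => j _.
rewrite !mxE /= rmorphM rmorphXn !morph_simp act_b act_rising act_X.
by rewrite shift_index_ord mulrC.
Qed.

Definition vandermonde : R :=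
  \prod_(i < k) \prod_(j < k | (i < j)%N) (X i.+1 - X j.+1).

(** This is k (k - 1) / 2, written to match the double product of the Vandermonde determinant. *)
Definition increasing_pairs : nat := (\sum_(i < k) \sum_(j < k | i < j) 1)%N.

(** A Vandermonde determinant in the 1 + b x_j, whose factors are -b (x_i - x_j). *)
Lemma antisym_beta1 : antisym_beta 1 = (- b) ^+ increasing_pairs * vandermonde.
Proof.
have -> : antisym_beta 1 = antisym_beta (\prod_(j < k) rising b Y 0 0 (X j.+1)).
  by rewrite big1 // => j _; rewrite /rising big_geq.
rewrite antisym_beta_rising -det_tr.
have -> : (\matrix_(i < k, j < k) (rising b Y 0 0 (X i.+1) * (1 + b * X i.+1) ^+ j))^T
    = Vandermonde k (\row_(j < k) (1 + b * X j.+1)).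
  by apply/matrixP => i j; rewrite !mxE /rising big_geq // mul1r.
rewrite det_Vandermonde /vandermonde /increasing_pairs expr_sum -big_split.
apply: eq_bigr => i _; rewrite expr_sum -big_split; apply: eq_bigr => j _.
by rewrite !mxE expr1 /=; ring.
Qed.

Hypothesis b_lreg : GRing.lreg b.

Variables (w : 'S_n) (lam : nat -> nat).
Hypothesis lamS : forall i, (lam i.+1 <= lam i)%N.
Hypothesis w_first : forall i : 'I_n, (i < k)%N -> w i = (i + lam (k.-1 - i))%N :> nat.
Hypothesis w_last : forall i j : 'I_n, (k <= i < j)%N -> (w i < w j)%N.

Let lam_le i j : (i <= j)%N -> (lam j <= lam i)%N.
Proof.
elim: j => [|j IHj]; first by rewrite leqn0 => /eqP->.
by rewrite leq_eqVlt => /predU1P[->//|/IHj]; apply: leq_trans.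
Qed.

Let w_incr (i j : 'I_n) : (i < j < k)%N -> (w i < w j)%N.
Proof.
move=> /andP[ij jk]; rewrite !w_first ?(ltn_trans ij) //.
have := @lam_le (k.-1 - j) (k.-1 - i); lia.
Qed.

Let w_incr_le (i j : 'I_n) : (i <= j < k)%N -> (w i <= w j)%N.
Proof.
case/andP; rewrite leq_eqVlt => /predU1P[/val_inj->//|ij jk].
by rewrite ltnW // w_incr // ij.
Qed.

(** The first k values of v are those of w in decreasing order, so v j is w (k - 1 - j) = k - 1 - j
    + lam j. Being smaller than all earlier values, it equals its code entry. From position k on the
    values increase and the code vanishes. *)
Lemma sorted_code (v : 'S_n) : (forall j : 'I_n, (k <= j)%N -> v j = w j) ->
  (forall i : 'I_n, (i.+1 < k)%N -> ascent v i = false) ->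
  forall j : 'I_n, code v j = if (j < k)%N then (lam j + (k.-1 - j))%N else 0%N.
Proof.
move=> vw vk j.
have decr (i i' : 'I_n) : (i < i' < k)%N -> (v i' < v i)%N.
  move=> /andP[ii' i'k]; have := @no_ascent_decreasing n k v i i' kn vk.
  by rewrite (ltnW ii') i'k => /(_ isT); lia.
have decr_le (i i' : 'I_n) : (i <= i' < k)%N -> (v i' <= v i)%N.
  move=> ii'; have := @no_ascent_decreasing n k v i i' kn vk ii'.
  exact: leq_trans (leq_addr _ _).
(* Both permutations take every value once and agree from position k on, so their first k positions
   have equally many values below x. *)
have below x : (\sum_(i < n | (i < k)%N) (v i < x) = \sum_(i < n | (i < k)%N) (w i < x))%N.
  have tot (u : 'S_n) : (\sum_(i < n) (u i < x) = \sum_(i < n) (i < x))%N.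
    by rewrite [RHS](reindex_perm u).
  have := tot v; rewrite -(tot w) (bigID (fun i : 'I_n => (i < k)%N)) /=.
  rewrite [RHS](bigID (fun i : 'I_n => (i < k)%N)) /=.
  rewrite (eq_bigr (fun i => nat_of_bool (w i < x)%N) (P := fun i => ~~ _)) => [|i].
    exact: addIn.
  by rewrite -leqNgt => /vw ->.
have [jk|kj] := ltnP j k; last first.
  by apply: code_no_inversion => i ji; rewrite !vw ?w_last ?kj //; lia.
have rjk : (k.-1 - j < n)%N by lia.
pose r := Ordinal rjk.
have cnt (p : pred 'I_n) a c : (c <= k)%N ->
   (forall i : 'I_n, (i < k)%N -> p i = (a <= i < c)%N) ->
   (\sum_(i < n | (i < k)%N) p i = c - a)%N.
  move=> ck pE; rewrite -(@card_ord_between n) ?(leq_trans ck) // big_mkcond /=.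
  apply: eq_bigr => i _; case: ltnP => [/pE->//|ki].
  by rewrite [(i < c)%N]ltnNge (leq_trans ck ki) andbF.
have vwr : v j = w r :> nat.
  (* Among the first k values exactly k - 1 - j are smaller than [v j], and as many are smaller than
     [w r]; so both lie below the same thresholds x. *)
  have vr x : (v j < x)%N = (w r < x)%N.
    have lo : (v j < x)%N -> (k - j <= \sum_(i < n | (i < k)%N) (v i < x))%N.
      move=> vx; rewrite -(cnt (fun i : 'I_n => (j <= i < k)%N) j k) //.
      apply: leq_sum => i ik; rewrite ik andbT; case: (leqP j i) => // ji.
      by rewrite (leq_ltn_trans (decr_le j i _) vx) // ji ik.
    have hi : (x <= v j)%N -> (\sum_(i < n | (i < k)%N) (v i < x) <= k - j.+1)%N.
      move=> vx; rewrite -(cnt (fun i : 'I_n => (j.+1 <= i < k)%N) j.+1 k) //.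
      apply: leq_sum => i ik; rewrite ik andbT; case: (ltnP j i) => [_|ij]; first exact: leq_b1.
      by rewrite ltnNge (leq_trans vx) // decr_le // ij jk.
    have lo' : (w r < x)%N -> (k - j <= \sum_(i < n | (i < k)%N) (w i < x))%N.
      move=> wx; have <- : (r.+1 - 0 = k - j)%N by rewrite /=; lia.
      rewrite -(cnt (fun i : 'I_n => (0 <= i < r.+1)%N)) //=; last by lia.
      apply: leq_sum => i ik; case: (ltnP i (k.-1 - j).+1) => // ir.
      by rewrite (leq_ltn_trans (w_incr_le (j := r) _) wx) //= -ltnS ir; lia.
    have hi' : (x <= w r)%N -> (\sum_(i < n | (i < k)%N) (w i < x) <= k - j.+1)%N.
      move=> wx; have <- : (r - 0 = k - j.+1)%N by rewrite /=; lia.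
      rewrite -(cnt (fun i : 'I_n => (0 <= i < r)%N)) //=; last by lia.
      apply: leq_sum => i ik; case: (ltnP i (k.-1 - j)) => [_|ri]; first exact: leq_b1.
      by rewrite ltnNge (leq_trans wx) // w_incr_le // ik andbT.
    move: lo hi lo' hi'; rewrite below.
    by case: (ltnP (v j) x); case: (ltnP (w r) x) => //; lia.
  by apply/eqP; rewrite eqn_leq leqNgt -vr -leqNgt leqnn leqNgt vr -leqNgt leqnn.
rewrite code_eq_val => [|i ij]; last by rewrite decr // ij jk.
by rewrite vwr w_first /=; [|lia]; rewrite addnC; congr (lam _ + _)%N; lia.
Qed.

Lemma inversions_sorted (v : 'S_n) : (forall i : 'I_n, (i.+1 < k)%N -> ascent v i = false) ->
  inversions k v = increasing_pairs.
Proof.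
move=> vk; rewrite /inversions /increasing_pairs -sum1_card.
rewrite (big_ord_widen n (fun i => \sum_(j < k | (i < j)%N) 1)%N kn).
under [RHS]eq_bigr => i ik.
  rewrite (big_ord_widen_cond n (fun j => (i < j)%N) (fun=> 1%N) kn); over.
rewrite pair_big_dep /=; apply: eq_bigl => -[i j]; rewrite inE /=.
have [ij|] := ltnP i j; last by rewrite ?andbF.
have [jk|] := ltnP j k; last by rewrite ?andbF.
have := @no_ascent_decreasing n k v i j kn vk.
by rewrite (ltnW ij) jk (ltn_trans ij jk) => /(_ isT) /=; lia.
Qed.

Lemma antisym_beta_sorted (v : 'S_n) :
  (forall j : 'I_n, (k <= j)%N -> v j = w j) ->
  (forall i : 'I_n, (i.+1 < k)%N -> ascent v i = false) ->
  antisym_beta (F v) = bialternant b Y (fun i => X i.+1) k lam.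
Proof.
move=> vw vk; have cE := sorted_code vw vk.
rewrite dominant_formula => [|i iN]; last first.
  rewrite !cE /= modn_small //; case: ltnP => // ik; rewrite (ltnW ik).
  by have := lamS i; lia.
rewrite /bialternant -antisym_beta_rising; congr antisym_beta.
rewrite (big_ord_widen n (fun j => rising b Y 0 (lam j + (k.-1 - j)) (X j.+1)) kn).
rewrite [RHS]big_mkcond; apply: eq_bigr => j _; rewrite cE.
by case: ifP => // _; rewrite /rising big_geq.
Qed.

(** At an ascent with i + 1 < k, passing to the longer permutation adds one inversion among the
    first k positions, and [antisym_iso] accounts for the factor -b. So the left side is unchanged
    while the first k values get sorted. *)
Lemma antisym_beta_family (v : 'S_n) : (forall j : 'I_n, (k <= j)%N -> v j = w j) ->
  (- b) ^+ inversions k v * antisym_beta (F v) =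
  (- b) ^+ increasing_pairs * bialternant b Y (fun i => X i.+1) k lam.
Proof.
move: {2}(n * n - perm_length v)%N (leqnn (n * n - perm_length v)) => d.
elim: d v => [|d IHd] v vd vw;
  case: (pickP (fun i : 'I_n => (i.+1 < k)%N && ascent v i)) => [i /andP[ik vi]|none];
  try by (have vk (i : 'I_n) : (i.+1 < k)%N -> ascent v i = false
            by move=> ik; have := none i; rewrite ik);
         rewrite inversions_sorted // antisym_beta_sorted.
  have := perm_length_le (simple_refl i * v)%g; rewrite perm_length_ascent //; lia.
have iN : (i.+1 < n)%N by case/andP: vi.
rewrite (F_ascent vi) (antisym_iso (i := Ordinal (ltnW ik))) //.
rewrite -(IHd (simple_refl i * v)%g) ?inversions_ascent //; first by rewrite exprS; ring.
  have := perm_length_le (simple_refl i * v)%g; rewrite perm_length_ascent //; lia.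
move=> j kj; rewrite simple_reflM_id ?vw //.
  by rewrite -val_eqE /=; lia.
by rewrite -val_eqE /= modn_small //; lia.
Qed.

(** Every i with i + 1 < k is an ascent of w, so [F w] is a value of each of these isobaric
    operators. Hence it is symmetric and factors out of the antisymmetrization; the powers of -b
    then cancel. *)
Lemma grassmannian_formula :
  F w * vandermonde = bialternant b Y (fun i => X i.+1) k lam.
Proof.
have invw : inversions k w = 0%N.
  apply: eq_card0 => -[i j]; rewrite inE /=; apply/negbTE.
  by apply/negP => /andP[/w_incr/ltnW]; rewrite leqNgt => /negbTE->.
have inv s : act (shift_index s) (F w) = F w.
  apply: sw_symmetric => i ik; have iN : (i < n)%N by lia.
  rewrite (F_ascent (i := Ordinal iN)) ?sw_iso //.
  have iN' := leq_trans ik kn; rewrite /ascent iN' w_incr //=.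
  by rewrite modn_small // ltnSn.
have sym : antisym_beta (F w) = F w * antisym_beta 1.
  rewrite /antisym_beta /antisym mulr_sumr; apply: eq_bigr => s _.
  by rewrite (mulr1 beta_weight) [in LHS]rmorphM /= inv mulrA; apply: mulrC.
have := antisym_beta_family (v := w) (fun _ _ => erefl).
rewrite invw expr0 mul1r sym antisym_beta1 mulrCA.
by move=> e; apply: (@lregX _ (- b) increasing_pairs (lregN b_lreg)).
Qed.

End Antisymmetrization.
End Family.
End Isobaric.

(** * The polynomial ring *)

Lemma mulcm_divcm v (m : mon) : m v != 0%N -> mulcm (ucm v) (divcm m (ucm v)) = m.
Proof.
move=> mv; apply/eqP/cmP => i; rewrite mulcmE divcmE ucmE.
by case: eqVneq => [<-|_]; rewrite ?subn0 // subnKC ?lt0n.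
Qed.

Lemma pvarM_coef v (g : bpoly) (m : mon) :
  (pvar v * g)@_m = if m v == 0%N then 0 else g@_(divcm m (ucm v)).
Proof.
rewrite /pvar (mcoeffMl (<<ucm v>> : {malg _[_]})) msuppU1 big_seq_fset1.
rewrite mcoeffUU; case: eqVneq => [mv|mv].
  apply: big1 => k _; case: eqP => // /(congr1 (fun m : mon => m v)).
  by rewrite cmM cmUU mv.
have e k : (mmul (ucm v) k == m) = (k == divcm m (ucm v)).
  apply/eqP/eqP => [<-|->]; last exact: mulcm_divcm.
  by apply/eqP/cmP => i; rewrite divcmE cmM addKn.
under eq_bigr => k _ do rewrite e mul1r.
case: (msuppP g (divcm m (ucm v))) => h.
  rewrite (big_fsetD1 _ h) /= eqxx big1_fset ?addr0 // => k.
  by rewrite in_fsetD1 => /andP[/negPf->].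
rewrite big1_fset // => k kg _; case: eqP => // e'.
by rewrite e' in kg; rewrite kg in h.
Qed.

(** Monomials arise from variables by induction on the degree, and elements are combinations of
    monomials. *)
Lemma bpoly_ind (Q : bpoly -> Prop) :
  (forall c, Q (malgC c)) -> (forall v, Q (pvar v)) ->
  (forall f g, Q f -> Q g -> Q (f + g)) ->
  (forall f g, Q f -> Q g -> Q (f * g)) -> forall f, Q f.
Proof.
move=> QC QX QD QM f.
have Q1 (m : mon) : Q (<< m >> : {malg _[_]}).
  move: {-1}(mdeg m) (erefl (mdeg m)) => d; elim: d m => [|d IHd] m dm.
    by rewrite (mdeg_eq0I dm); apply: QC.
  have [v mv] : exists v, m v != 0%N.
    have : finsupp (cmonom_val m) != fset0.
      apply: contra_eq_neq dm => /= e.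
      by rewrite mdegE e big_seq_fset0.
    by case/fset0Pn => v; rewrite -cmE_neq0; exists v.
  have e : m = mmul (ucm v) (divcm m (ucm v)) by rewrite [RHS]mulcm_divcm.
  have -> : << m >> = pvar v * (<< divcm m (ucm v) >> : {malg _[_]}) :> bpoly.
    rewrite [X in << X >>]e /pvar malgM_def.
    by rewrite fgmulUU mulr1.
  apply: QM => //; apply: IHd; apply: succn_inj.
  by rewrite -dm [in RHS]e mdegM mdegU.
rewrite [f]monalgE; elim/big_ind: _ => // [|m _]; first by rewrite -malgC0E.
have -> : << f@_m *g m >> = malgC f@_m * (<< m >> : {malg _[_]}) :> bpoly.
  by rewrite malgM_def fgmulUU mulr1 mul1m.
by apply: QM; [apply: QC|apply: Q1].
Qed.

(** The monomial part of [psubst]; its multiplicativity makes [psubst] an instance of [mmap], hence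
    a ring morphism. *)
Definition moneval (s : var -> bpoly) (m : mon) : bpoly :=
  \prod_(v <- finsupp (cmonom_val m)) s v ^+ m v.

Lemma monevalE s (m : mon) (A : {fset var}) :
  (finsupp (cmonom_val m) `<=` A)%fset -> moneval s m = \prod_(v <- A) s v ^+ m v.
Proof.
move=> mA; apply: big_fset_incl => // v _ h.
suff -> : m v = 0%N by rewrite expr0.
by apply/eqP; rewrite cmE_eq0.
Qed.

Lemma moneval_mmorphism s : mmorphism (moneval s).
Proof.
split=> [m1 m2|]; last by rewrite /moneval mdom1 big_seq_fset0.
rewrite [LHS](monevalE _ (A := finsupp (cmonom_val m1)
   `|` finsupp (cmonom_val m2))%fset) ?mdomD ?fsubset_refl //.
rewrite (monevalE _ (fsubsetUl _ (finsupp (cmonom_val m2)))).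
rewrite (monevalE _ (fsubsetUr (finsupp (cmonom_val m1)) _)).
by rewrite -big_split; apply: eq_bigr => v _; rewrite cmM exprD.
Qed.

HB.instance Definition _ s := isMultiplicative.Build mon bpoly (moneval s)
  (moneval_mmorphism s).

Lemma psubstE s f : psubst s f = mmap malgC (moneval s) f.
Proof. by []. Qed.

Fact psubst_is_zmod_morphism s : zmod_morphism (psubst s).
Proof. by move=> f g; rewrite !psubstE raddfB. Qed.

Fact psubst_is_monoid_morphism s : monoid_morphism (psubst s).
Proof.
split; first by rewrite psubstE rmorph1.
by move=> f g; rewrite !psubstE rmorphM.
Qed.

HB.instance Definition _ s := GRing.isZmodMorphism.Build bpoly bpoly (psubst s)
  (psubst_is_zmod_morphism s).
HB.instance Definition _ s := GRing.isMonoidMorphism.Build bpoly bpoly (psubst s)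
  (psubst_is_monoid_morphism s).

Lemma psubstC s c : psubst s (malgC c) = malgC c.
Proof. by rewrite psubstE mmapU /moneval mdom1 big_seq_fset0 mulr1. Qed.

Lemma psubst_beta s : psubst s beta = beta. Proof. exact: psubstC. Qed.

Lemma psubst_var s v : psubst s (pvar v) = s v.
Proof.
rewrite psubstE mmapU /moneval mdomU big_seq_fset1 cmUU expr1.
by rewrite mul_malgC scale1r.
Qed.

Lemma rmorph_bpoly_ext (u v : {rmorphism bpoly -> bpoly}) :
  (forall c, u (malgC c) = v (malgC c)) -> (forall w, u (pvar w) = v (pvar w)) ->
  u =1 v.
Proof.
move=> hC hX; elim/bpoly_ind => // f g Hf Hg.
  by rewrite !rmorphD /= Hf Hg.
by rewrite !rmorphM /= Hf Hg.
Qed.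

Lemma psubst_comp s s' f : psubst s (psubst s' f) = psubst (psubst s \o s') f.
Proof.
apply: (rmorph_bpoly_ext (u := psubst s \o psubst s')) => [c|v] /=.
  by rewrite !psubstC.
by rewrite !psubst_var.
Qed.

Lemma eq_psubst s s' f : s =1 s' -> psubst s f = psubst s' f.
Proof.
move=> e; apply: (rmorph_bpoly_ext (u := psubst s) (v := psubst s')) => [c|v] /=.
  by rewrite !psubstC.
by rewrite !psubst_var e.
Qed.

Lemma psubst_id f : psubst pvar f = f.
Proof.
by apply: (rmorph_bpoly_ext (v := idfun)) => [c|v] /=; rewrite (psubstC, psubst_var).
Qed.

Lemma beta_coef (g : bpoly) m : (beta * g)@_m = 'X * g@_m.
Proof. exact: mcoeffCM. Qed.

Lemma beta_lreg : GRing.lreg beta.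
Proof.
apply: mulrI0_lreg => g /malgP h; apply/malgP => m.
move: (h m); rewrite beta_coef !mcoeff0 => /eqP.
by rewrite mulf_eq0 polyX_eq0 /= => /eqP.
Qed.

Lemma two_lreg (g : bpoly) : g *+ 2 = 0 -> g = 0.
Proof.
move=> /malgP h; apply/malgP => m; move: (h m); rewrite mcoeffMn !mcoeff0.
move/polyP => h2; apply/polyP => i; move: (h2 i).
by rewrite coefMn !coef0 => /eqP; rewrite Num.Theory.mulrn_eq0 /= => /eqP.
Qed.

(** If x_i g = x_j g, the coefficient of g at m is its coefficient at x_i m / x_j, or 0 when x_j
    does not divide m. Induction on the exponent of x_j concludes. *)
Lemma pxB_lreg i j : i != j -> GRing.lreg (px i - px j).
Proof.
move=> ij; apply: mulrI0_lreg => g h; apply/malgP => m; rewrite mcoeff0.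
have step m' : g@_m' = (px j * g)@_(mmul (ucm (inl i)) m').
  have e : (px i * g - px j * g)@_(mmul (ucm (inl i)) m') = 0.
    by rewrite -mulrBl h mcoeff0.
  have -> : g@_m' = g@_(divcm (mmul (ucm (inl i)) m') (ucm (inl i))).
    congr (mcoeff _ g); apply/eqP/cmP => v; by rewrite divcmE cmM addKn.
  by rewrite mcoeffB in e; rewrite -(subr0_eq e) (pvarM_coef (inl i)) cmM cmUU.
have ji : inl i == inl j :> var = false by apply: contraNF ij => /eqP[->].
move: {-1}(m (inl j)) (erefl (m (inl j))) => d; elim: d m => [|d IHd] m md.
  by rewrite step (pvarM_coef (inl j)) cmM cmU ji md.
rewrite step (pvarM_coef (inl j)) cmM cmU ji md /= IHd //.
by rewrite divcmE cmM !cmU ji md eqxx subn1.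
Qed.

(** If the product with g is 0, then g = - beta x g; each use of this lowers the exponent of x in
    the monomial considered, until the coefficient vanishes. *)
Lemma one_betaM_lreg v : GRing.lreg (1 + beta * pvar v).
Proof.
apply: mulrI0_lreg => g h; apply/malgP => m; rewrite mcoeff0.
have dist : (1 + beta * pvar v) * g = g + beta * (pvar v * g) by ring.
have step m' : g@_m' = - ('X * (pvar v * g)@_m').
  have e : g@_m' + (beta * (pvar v * g))@_m' = 0.
    rewrite -mcoeffD. rewrite -dist. rewrite h. rewrite mcoeff0. by [].
  rewrite (beta_coef (pvar v * g) m') in e.
  apply/eqP. rewrite -addr_eq0. rewrite e. by [].
move: {-1}(m v) (erefl (m v)) => d; elim: d m => [|d IHd] m md.
  by rewrite step (pvarM_coef v) md mulr0 oppr0.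
rewrite step (pvarM_coef v) md /= IHd ?mulr0 ?oppr0 //.
by rewrite divcmE md ucmE eqxx subn1.
Qed.

(** * Set-valued tableaux *)

Section Tableaux.
Variables (R : comNzRingType) (b : R) (z : nat -> nat -> nat -> R) (p q : nat).

Local Notation cell := ('I_p * 'I_q)%type.
Implicit Types (a c : cell) (L M S : {set cell}).

Definition right_of a c : bool := (c.1 == a.1) && (c.2 == a.2.+1 :> nat).
Definition below a c : bool := (c.1 == a.1.+1 :> nat) && (c.2 == a.2).

(* The cells M of the entries smaller than the largest one and the cells S
   containing the largest one, for a set-valued tableau of shape L. *)
Definition peeling L M S : bool :=
  [&& M :|: S == L,
      [forall a in S, forall c, right_of a c ==> (c \notin M)]
    & [forall a in S, forall c, below a c ==> (c \notin L)]].

Lemma peelingP L M S : reflect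
  [/\ M :|: S = L, forall a c, a \in S -> right_of a c -> c \notin M
    & forall a c, a \in S -> below a c -> c \notin L] (peeling L M S).
Proof.
apply: (iffP and3P) => [[/eqP e h1 h2]|[e h1 h2]]; split=> //.
- by move=> a c aS; move/forall_inP/(_ a aS)/forallP/(_ c)/implyP: h1.
- by move=> a c aS; move/forall_inP/(_ a aS)/forallP/(_ c)/implyP: h2.
- exact/eqP.
- by apply/forall_inP => a aS; apply/forallP => c; apply/implyP; apply: h1.
- by apply/forall_inP => a aS; apply/forallP => c; apply/implyP; apply: h2.
Qed.

(** The generating function of set-valued fillings, by recursion on the largest entry. A cell of S
    outside M has that entry alone; a cell of both S and M has an additional entry and so a factor
    b. *)
Fixpoint peeledG k L : R :=
  if k is k'.+1 then
    \sum_(M : {set cell}) \sum_(S : {set cell} | peeling L M S)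
      peeledG k' M * (b ^+ #|S :&: M| * \prod_(a in S) z k' a.1 a.2)
  else (L == set0)%:R.

Section Fillings.
Variable K : nat.
Implicit Types (T : {ffun cell -> {set 'I_K}}).

Definition filled T : {set cell} := [set a | T a != set0].

(** Fillings live on a whole rectangle and empty cells impose no condition, so the shape may shrink
    as entries are removed. *)
Definition semistandard k T : bool :=
  [&& [forall a, forall r in T a, (r < k)%N],
      [forall a, forall c, right_of a c ==>
         [forall r in T a, forall s in T c, (r <= s)%N]]
    & [forall a, forall c, below a c ==>
         [forall r in T a, forall s in T c, (r < s)%N]]].

Lemma semistandardP k T : reflect
  [/\ forall a r, r \in T a -> (r < k)%N,
      forall a c r s, right_of a c -> r \in T a -> s \in T c -> (r <= s)%N
    & forall a c r s, below a c -> r \in T a -> s \in T c -> (r < s)%N]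
  (semistandard k T).
Proof.
apply: (iffP and3P) => [[h0 h1 h2]|[h0 h1 h2]]; split.
- by move=> a r ra; move/forallP/(_ a)/forall_inP/(_ r ra): h0.
- move=> a c r s ac ra sc.
  by move/forallP/(_ a)/forallP/(_ c)/implyP/(_ ac)/forall_inP/(_ r ra)/forall_inP: h1; apply.
- move=> a c r s ac ra sc.
  by move/forallP/(_ a)/forallP/(_ c)/implyP/(_ ac)/forall_inP/(_ r ra)/forall_inP: h2; apply.
- by apply/forallP => a; apply/forall_inP => r; apply: h0.
- apply/forallP => a; apply/forallP => c; apply/implyP => ac.
  by apply/forall_inP => r ra; apply/forall_inP => s sc; apply: (h1 a c).
- apply/forallP => a; apply/forallP => c; apply/implyP => ac.
  by apply/forall_inP => r ra; apply/forall_inP => s sc; apply: (h2 a c).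
Qed.

(** The truncated predecessor gives empty cells the weight 1. *)
Definition weight T : R :=
  \prod_a (b ^+ #|T a|.-1 * \prod_(r in T a) z r a.1 a.2).

Section Peel.
Variable k : 'I_K.

Definition add_entry (TS : {ffun cell -> {set 'I_K}} * {set cell}) :
    {ffun cell -> {set 'I_K}} :=
  [ffun a => if a \in TS.2 then k |: TS.1 a else TS.1 a].

Definition remove_entry T : {ffun cell -> {set 'I_K}} * {set cell} :=
  ([ffun a => T a :\ k], [set a | k \in T a]).

Lemma remove_entryK T : add_entry (remove_entry T) = T.
Proof.
apply/ffunP => a; rewrite !ffunE inE; case: ifP => ka; first exact: setD1K.
by apply/setDidPl; rewrite disjoint_sym disjoints1 ka.
Qed.

Lemma add_entryK T S : (remove_entry (add_entry (T, S)) == (T, S)) =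
  [forall a, k \notin T a].
Proof.
apply/eqP/forallP => [[/ffunP e _] a|h].
  by rewrite -(e a) !ffunE setD11.
congr (_, _).
  apply/ffunP => a; rewrite !ffunE; have ka := h a.
  case: ifP => _; first by rewrite setU1K.
  by apply/setDidPl; rewrite disjoint_sym disjoints1 ka.
apply/setP => a; rewrite inE ffunE /=; have ka := h a.
by case: ifP => aS; rewrite ?setU11 // (negPf ka).
Qed.

Lemma filled_add_entry T S : filled (add_entry (T, S)) = filled T :|: S.
Proof.
apply/setP => a; rewrite !inE ffunE /=; case: ifP => _; last by rewrite orbF.
by rewrite orbT; apply/set0Pn; exists k; rewrite setU11.
Qed.

(** As k exceeds all entries of T, adding it to the cells of S constrains only their neighbours: no
    smaller entry immediately to the right, and no entry at all immediately below. *)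
Lemma semistandard_add_entry L T S :
  [&& filled (add_entry (T, S)) == L, semistandard k.+1 (add_entry (T, S))
    & remove_entry (add_entry (T, S)) == (T, S)] =
  semistandard k T && peeling L (filled T) S.
Proof.
rewrite add_entryK filled_add_entry.
have inT a r : r \in add_entry (T, S) a = (a \in S) && (r == k) || (r \in T a).
  by rewrite ffunE /=; case: ifP; rewrite ?inE.
have neq0 a r : r \in T a -> a \in filled T.
  by move=> ra; rewrite inE; apply/set0Pn; exists r.
apply/and3P/andP => [[/eqP LE /semistandardP[h0 h1 h2] /forallP kT]|].
  split; first (apply/semistandardP; split).
  - move=> a r ra; have := h0 a r; rewrite inT ra orbT ltnS => /(_ isT).
    rewrite leq_eqVlt => /predU1P[/val_inj rk|//].
    by have := kT a; rewrite -rk ra.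
  - by move=> a c r s ac ra sc; apply: (h1 a c) => //; rewrite inT (ra, sc) orbT.
  - by move=> a c r s ac ra sc; apply: (h2 a c) => //; rewrite inT (ra, sc) orbT.
  apply/peelingP; split=> // a c aS ac.
    apply/negP; rewrite inE => /set0Pn[s sc].
    have ks : (k <= s)%N.
      by apply: (h1 a c) => //; rewrite inT ?aS ?eqxx ?sc ?orbT.
    have := h0 c s; rewrite inT sc orbT ltnS => /(_ isT) sk.
    have sk' : s = k by apply/val_inj/eqP; rewrite eqn_leq sk.
    by have := kT c; rewrite -sk' sc.
  have ka : k \in add_entry (T, S) a by rewrite inT aS eqxx.
  apply/negP; rewrite -LE -filled_add_entry inE => /set0Pn[s sc].
  by have := h2 a c k s ac ka sc; have := h0 c s sc; lia.
move=> [/semistandardP[h0 h1 h2] /peelingP[LE h3 h4]].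
have kT a : k \notin T a by apply/negP => /h0; rewrite ltnn.
split; [exact/eqP| |exact/forallP].
apply/semistandardP; split.
- move=> a r; rewrite inT => /orP[/andP[_ /eqP->]//|/h0]; lia.
- move=> a c r s ac; rewrite !inT => /orP[/andP[aS /eqP->]|ra].
    move=> /orP[/andP[_ /eqP->]//|sc].
    by have := h3 a c aS ac; rewrite (neq0 _ _ sc).
  move=> /orP[/andP[_ /eqP->]|sc]; first by have := h0 _ _ ra; lia.
  exact: (h1 a c).
- move=> a c r s ac; rewrite !inT => /orP[/andP[aS /eqP->]|ra].
    have cL := h4 a c aS ac; rewrite -LE inE negb_or in cL.
    move=> /orP[/andP[cS _]|sc]; first by case/andP: cL => _ /negP.
    by case/andP: cL; rewrite (neq0 _ _ sc).
  move=> /orP[/andP[_ /eqP->]|sc]; first exact: h0 ra.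
  exact: (h2 a c).
Qed.

Lemma weight_add_entry T S : (forall a, k \notin T a) ->
  weight (add_entry (T, S)) =
  weight T * (b ^+ #|S :&: filled T| * \prod_(a in S) z k a.1 a.2).
Proof.
move=> kT; rewrite -[b ^+ #|_|]prodr_const.
rewrite (big_mkcond (fun a => a \in S :&: _)) (big_mkcond (fun a => a \in S)).
rewrite -!big_split /=; apply: eq_bigr => a _; rewrite ffunE !inE /=.
case: ifP => aS /=; last by rewrite !mulr1.
rewrite big_setU1 ?kT //= cardsU1 kT /=.
have [->|Ta] := eqVneq (T a) set0; first by rewrite cards0 big_set0 /= ?eqxx /=; ring.
have : (0 < #|T a|)%N by rewrite card_gt0.
by case: #|T a| => // m _; rewrite /= exprS; ring.
Qed.

End Peel.

(** Splitting a filling into its smaller entries and the set of cells containing the largest one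
    reproduces the recursion. *)
Lemma peeledG_tableaux k L : (k <= K)%N ->
  \sum_(T : {ffun cell -> {set 'I_K}} | (filled T == L) && semistandard k T)
    weight T = peeledG k L.
Proof.
elim: k L => [|k IHk] L kK.
  have T0 T : semistandard 0 T -> T = [ffun=> set0].
    case/semistandardP => h _ _; apply/ffunP => a; rewrite ffunE; apply/setP => r.
    by rewrite inE; apply/negP => /h.
  have s0 : semistandard 0 ([ffun=> set0] : {ffun cell -> {set 'I_K}}).
    by apply/semistandardP; split=> [a r|a c r s _|a c r s _]; rewrite ffunE inE.
  have f0 : filled [ffun=> set0] = set0.
    by apply/setP => a; rewrite !inE ffunE eqxx.
  rewrite /=; case: eqVneq => [->|L0]; last first.
    rewrite big1 // => T /andP[/eqP e /T0 T0e]; move: L0.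
    by rewrite -e T0e f0 eqxx.
  rewrite (big_pred1 [ffun=> set0]) => [|T].
    rewrite /weight big1 // => a _; rewrite ffunE cards0 big_set0 expr0; ring.
  apply/andP/eqP => [[_ /T0//]|->]; by rewrite f0 eqxx.
pose kk := Ordinal kK.
rewrite (reindex_onto (add_entry kk) (remove_entry kk)) /=; last first.
  by move=> T _; apply: remove_entryK.
transitivity (\sum_(T : {ffun cell -> {set 'I_K}} | semistandard k T)
   \sum_(S | peeling L (filled T) S)
     weight T * (b ^+ #|S :&: filled T| * \prod_(a in S) z k a.1 a.2)).
  rewrite pair_big_dep; apply: eq_big => [[T S]|[T S]].
    by rewrite -andbA (semistandard_add_entry kk).
  rewrite -andbA (semistandard_add_entry kk) => /andP[/semistandardP[h _ _] _].
  by rewrite weight_add_entry // => a; apply/negP => /h; rewrite ltnn.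
symmetry; under eq_bigr => M _.
  under eq_bigr => S _ do rewrite -IHk ?(ltnW kK) // mulr_suml.
  rewrite exchange_big /=; over.
rewrite (exchange_big_dep predT) //= [RHS]big_mkcond.
apply: eq_bigr => T _; case: ifP => sT; last by rewrite big_pred0 // => M; rewrite andbF.
by rewrite (big_pred1 (filled T)) // => M; rewrite andbT eq_sym.
Qed.

End Fillings.
End Tableaux.

Definition diagram p q (lam : nat -> nat) : {set 'I_p * 'I_q} :=
  [set a : 'I_p * 'I_q | (a.2 < lam a.1)%N].

(** * Tableaux on boxes as fillings of a rectangle *)

Section Boxes.
Variables (la : seq nat) (K : nat).
Hypothesis la_part : is_partition la.

Local Notation cell := ('I_(size la) * 'I_(head 0%N la))%type.
Local Notation shape := (diagram (size la) (head 0%N la) (nth 0%N la)).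

Lemma nth_partition i : (nth 0%N la i.+1 <= nth 0%N la i)%N.
Proof.
case/andP: la_part => la_s _; case: (ltnP i.+1 (size la)) => h; last first.
  by rewrite nth_default.
by apply: (sorted_ltn_nth (leT := geq)) => // [u v w /= uv /leq_trans|]; [apply|exact: ltnW].
Qed.

Lemma nth_le_head i : (nth 0%N la i <= head 0%N la)%N.
Proof.
by rewrite -nth0; elim: i => // i; apply: leq_trans; apply: nth_partition.
Qed.

Lemma big_box (T : Type) (idx : T) (op : Monoid.com_law idx) (F : cell -> T) :
  \big[op/idx]_(a in shape) F a = \big[op/idx]_(x : box la) F (val x).
Proof.
rewrite (reindex_omap (val : box la -> cell) insub) => [|a]; last first.
  by rewrite inE => aP; rewrite insubT.
by apply: eq_bigl => x; rewrite inE (valP x) valK eqxx.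
Qed.

Lemma card_box : #|{: box la}| = sumn la.
Proof.
rewrite -sum1_card -(big_box addn (fun=> 1%N)) /=.
transitivity (\sum_(i < size la) \sum_(j < head 0 la | j < nth 0 la i) 1)%N.
  by rewrite pair_big_dep /=; apply: eq_bigl => a; rewrite inE.
rewrite sumnE (big_nth 0%N) big_mkord; apply: eq_bigr => i _.
by rewrite -(big_ord_widen _ (fun=> 1%N) (nth_le_head i)) sum1_card card_ord.
Qed.

Definition extend (T : svfilling la K) : {ffun cell -> {set 'I_K}} :=
  [ffun a => oapp (fun x : box la => T x) set0 (insub a)].

Definition restrict (T : {ffun cell -> {set 'I_K}}) : svfilling la K :=
  [ffun x => T (val x)].

Lemma extend_val T (x : box la) : extend T (val x) = T x.
Proof. by rewrite ffunE valK. Qed.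

Lemma extend_out T a : a \notin shape -> extend T a = set0.
Proof. by rewrite inE ffunE => h; rewrite insubN. Qed.

Lemma shapeP a : a \in shape -> exists x : box la, a = val x.
Proof. by rewrite inE => h; exists (Sub a h); rewrite SubK. Qed.

Lemma extend_mem T a r : r \in extend T a -> a \in shape.
Proof. by apply: contraLR => /extend_out->; rewrite inE. Qed.

Lemma svtableau_extend (T : svfilling la K) :
  is_svtableau T = (filled (extend T) == shape) && semistandard K (extend T).
Proof.
apply/and3P/andP => [[/forallP T0 Tr Tb]|[/eqP Tf /semistandardP[_ hr hb]]].
  split.
    apply/eqP/setP => a; rewrite inE; apply/idP/idP => [|/shapeP[x ->]].
      by apply: contraLR => /extend_out->; rewrite eqxx.
    by rewrite extend_val.
  apply/semistandardP; split=> // a c r s ac ra sc.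
    move: (extend_mem ra) (extend_mem sc) => /shapeP[x ax] /shapeP[x' cx].
    subst a c; rewrite !extend_val in ra sc.
    move/forallP/(_ x)/forallP/(_ x')/implyP: Tr; rewrite /brow /bcol.
    by move/(_ ac)/forall_inP/(_ r ra)/forall_inP/(_ s sc).
  move: (extend_mem ra) (extend_mem sc) => /shapeP[x ax] /shapeP[x' cx].
  subst a c; rewrite !extend_val in ra sc.
  move/forallP/(_ x)/forallP/(_ x')/implyP: Tb; rewrite /brow /bcol.
  by move/(_ ac)/forall_inP/(_ r ra)/forall_inP/(_ s sc).
split.
- apply/forallP => x; have := valP x; rewrite -extend_val.
  have -> : (extend T (val x) != set0) = (val x \in filled (extend T)) by rewrite inE.
  by rewrite Tf inE.
- apply/forallP => x; apply/forallP => x'; apply/implyP => xx'.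
  apply/forall_inP => r rx; apply/forall_inP => s sx'.
  by apply: (hr (val x) (val x') r s); rewrite ?extend_val.
- apply/forallP => x; apply/forallP => x'; apply/implyP => xx'.
  apply/forall_inP => r rx; apply/forall_inP => s sx'.
  by apply: (hb (val x) (val x') r s); rewrite ?extend_val.
Qed.

Lemma extend_restrict T : filled T = shape -> extend (restrict T) = T.
Proof.
move=> Tf; apply/ffunP => a; have [aS|aS] := boolP (a \in shape).
  by case: (shapeP aS) => x ->; rewrite extend_val ffunE.
by rewrite extend_out //; apply/esym/eqP; move: aS; rewrite -Tf inE negbK.
Qed.

Variables (R : comNzRingType) (b : R) (z : nat -> nat -> nat -> R).

(** Boxes of a tableau are non-empty, so |T| - |lambda| is the sum of the |T(a)| - 1. *)
Lemma svtableaux_peeledG :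
  \sum_(T : svfilling la K | is_svtableau T) b ^+ (svsize T - sumn la) *
     \prod_(a : box la) \prod_(r in T a) z r (brow a) (bcol a) =
  peeledG b z K shape.
Proof.
rewrite -(peeledG_tableaux b z _ (leqnn K)) (reindex_onto extend restrict); last first.
  by move=> T /andP[/eqP/extend_restrict].
apply: eq_big => [T|T svT].
  rewrite svtableau_extend; case: (_ && _) => //=; apply/esym/eqP/ffunP => x.
  by rewrite ffunE extend_val.
rewrite /weight (bigID (fun a => a \in shape)) /= [X in _ = _ * X]big1 ?mulr1; last first.
  by move=> a /extend_out->; rewrite cards0 big_set0 expr0; ring.
rewrite (big_box _ (fun a => _ * _)).
under [RHS]eq_bigr => x _ do rewrite extend_val.
rewrite big_split /= -expr_sum; congr (b ^+ _ * _).
rewrite /svsize -card_box -sum1_card -sumnB => [|x _]; last first.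
  by rewrite card_gt0; case/and3P: svT => /forallP.
by apply: eq_bigr => x _; rewrite subn1.
Qed.

End Boxes.

(** * Branching of the tableau sum with factorial weights *)

Section FactorialWeights.
Variables (R : comNzRingType) (b : R) (X Y : nat -> R) (p q : nat).

Local Notation x := (fun i => X i.+1).
Local Notation cell := ('I_p * 'I_q)%type.
Local Notation dia := (diagram p q).

Definition box_factor (r i j : nat) : R := fsum b (X r.+1) (Y (r.+1 + j - i)).

Local Notation G := (peeledG b box_factor).

Lemma prod_interval (f : nat -> R) m l : (l <= q)%N ->
  \prod_(j < q) (if (m <= j < l)%N then f j else 1) = \prod_(m <= t < l) f t.
Proof.
move=> lq; rewrite (big_nat_widen _ _ q) // (big_nat_widenl _ 0) //.
rewrite -(big_mkord predT (fun j => if (m <= j < l)%N then f j else 1)).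
by rewrite -big_mkcond; apply: eq_bigl => j; rewrite /= andbC.
Qed.

Lemma prod_point (c : R) (B : bool) m : (m <= q)%N -> (B -> (0 < m)%N) ->
  \prod_(j < q) (if (j.+1 == m) && B then c else 1) = if B then c else 1.
Proof.
move=> mq; case: B => [/(_ isT) m0|_]; last first.
  by rewrite big1 // => j _; rewrite andbF.
have mq' : (m.-1 < q)%N by lia.
rewrite (bigD1 (Ordinal mq')) //= prednK // eqxx big1 ?mulr1 // => j.
by rewrite andbT -val_eqE /= => jm; case: eqP => // jm'; rewrite -jm' eqxx in jm.
Qed.

Lemma row_weight_out k lam mu i : lam i = 0%N -> (mu i <= lam i)%N ->
  row_weight b Y x k lam mu i = 1.
Proof.
move=> li; rewrite li leqn0 => /eqP mi; rewrite /row_weight li mi ltn0.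
by rewrite big_geq // mulr1.
Qed.

(* Each row contributes independently: the cells beyond mu must contain the largest
   entry, and the last cell of mu may contain it if no cell of lam is below. *)
Lemma sum_peeling k (lam mu : nat -> nat) :
  (forall i, lam i.+1 <= mu i <= lam i)%N -> (lam 0 <= q)%N -> lam p = 0%N ->
  \sum_(S | peeling (dia lam) (dia mu) S)
     (b ^+ #|S :&: dia mu| * \prod_(a in S) box_factor k a.1 a.2) =
  \prod_(i < p) row_weight b Y x k lam mu i.
Proof.
move=> inter lamq lamp.
have lamS i : (lam i.+1 <= lam i)%N by case/andP: (inter i); apply: leq_trans.
have lam_q i : (lam i <= q)%N by elim: i => // i; apply: leq_trans.
have mu_q i : (mu i <= q)%N by case/andP: (inter i) => _ /leq_trans; apply.
pose skew (a : cell) := (mu a.1 <= a.2 < lam a.1)%N.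
pose corner (a : cell) := (a.2.+1 == mu a.1) && (lam a.1.+1 < mu a.1)%N.
pose w (a : cell) := box_factor k a.1 a.2.
(* [f a] and [g a] are the contributions of a cell inside and outside S; impossible choices
   contribute 0. *)
pose f a := if skew a then w a else if corner a then b * w a else 0.
pose g a := if skew a then 0 else 1 : R.
have skew_corner a : skew a -> corner a = false.
  rewrite /skew /corner => /andP[h _]; apply/negbTE; lia.
have peelE S : peeling (dia lam) (dia mu) S =
    [forall a, if skew a then a \in S else (a \in S) ==> corner a].
  apply/peelingP/forallP => [[e hr hb] a|h].
    case: ifP => [sk|nsk].
      have : a \in dia lam by rewrite inE; case/andP: sk.
      by rewrite -e !inE; case/andP: sk; rewrite leqNgt => /negbTE->.
    apply/implyP => aS; have : a \in dia lam by rewrite -e inE aS orbT.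
    rewrite inE => al; have am : (a.2 < mu a.1)%N.
      by rewrite ltnNge; apply: contraFN nsk => h; rewrite /skew h.
    apply/andP; split.
      rewrite eqn_leq am /=; apply: contraT; rewrite -ltnNge => h.
      have hq : (a.2.+1 < q)%N by apply: leq_trans h (mu_q _).
      have := hr a (a.1, Ordinal hq) aS; rewrite /right_of /= !eqxx inE /= h.
      by move/(_ isT).
    rewrite ltnNge; apply/negP => h.
    have hp : (a.1.+1 < p)%N.
      rewrite ltn_neqAle ltn_ord andbT; apply/eqP => e1.
      by rewrite e1 lamp leqn0 in h; rewrite (eqP h) in am.
    have := hb a (Ordinal hp, a.2) aS; rewrite /below /= !eqxx inE /=.
    by rewrite (leq_trans am h) => /(_ isT).
  have S_or a : a \in S -> skew a \/ corner a.
    by move=> aS; have := h a; rewrite aS; case: ifP; [left|right].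
  split.
  - apply/setP => a; rewrite !inE; have := h a; have := inter a.1.
    rewrite /skew; case: (ltnP a.2 (mu a.1)) => /= [am|ma] /andP[_ ml].
      by rewrite (leq_trans am ml).
    case: ifP => [_ ->//|_].
    case: (a \in S) => //= /andP[/eqP e _]; lia.
  - move=> a c /S_or ac /andP[/eqP c1 /eqP c2]; rewrite inE c1 c2 -leqNgt.
    by case: ac => /andP[]; [lia|move/eqP->].
  - move=> a c /S_or ac /andP[/eqP c1 /eqP c2]; rewrite inE c1 c2 -leqNgt.
    have := inter a.1; case: ac => /andP[]; [lia|move/eqP => <-]; lia.
(* Expanding this product gives a sum over all S, in which those that are not peelings vanish. *)
transitivity (\prod_a (f a + g a)).
  rewrite bigA_distr big_mkcond /=; apply: eq_bigr => S _.
  rewrite peelE; case: forallP => [h|/forallP]; last first.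
    rewrite negb_forall => /existsP[a ha]; apply/esym; rewrite (bigD1 a) //=.
    move: ha; rewrite /f /g; case: ifP => [_ /negbTE->|_]; first by rewrite mul0r.
    by rewrite negb_imply => /andP[-> /negbTE->]; rewrite mul0r.
  rewrite -[b ^+ #|_|]prodr_const.
  rewrite (big_mkcond (fun a => a \in S :&: _)) (big_mkcond (fun a => a \in S)).
  rewrite -big_split; apply: eq_bigr => a _; rewrite !inE /f /g /= -/(w a).
  have := h a; case: ifP => [sk aS|sk].
    by rewrite aS /=; case/andP: sk; rewrite leqNgt => /negbTE-> _; rewrite mul1r.
  case: (boolP (a \in S)) => aS /=; last by rewrite mul1r.
  by move=> co; rewrite co; case/andP: co => /eqP <-; rewrite ltnSn.
rewrite -(pair_bigA _ (fun i j => f (i, j) + g (i, j))) /=; apply: eq_bigr => i _.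
transitivity (\prod_(j < q) ((if (j.+1 == mu i) && (lam i.+1 < mu i)%N
     then 1 + b * fsum b (X k.+1) (Y (mu i + k - i)) else 1)
   * (if (mu i <= j < lam i)%N then fsum b (X k.+1) (Y (j + k.+1 - i)) else 1))).
  apply: eq_bigr => j _; rewrite /f /g.
  have := @skew_corner (i, j); rewrite /skew /corner /=.
  case: ifP => [_ /(_ isT)->|_ _].
    by rewrite addr0 mul1r /w /box_factor /= (addnC k.+1).
  rewrite mulr1; case: ifP => [/andP[/eqP e _]|_]; last by rewrite add0r.
  rewrite addrC /w /box_factor /=; congr (1 + b * fsum _ _ (Y _)); lia.
rewrite big_split /= prod_point //; last by lia.
by rewrite (prod_interval (fun t => fsum b (X k.+1) (Y (t + k.+1 - i)))).
Qed.

Lemma prod_row_weight k lam mu : (forall i, mu i <= lam i)%N ->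
  (forall i, (k < i)%N -> lam i = 0%N) -> (forall i, (p <= i)%N -> lam i = 0%N) ->
  \prod_(i < p) row_weight b Y x k lam mu i =
  \prod_(i < k.+1) row_weight b Y x k lam mu i.
Proof.
move=> mul lk lp; pose F := row_weight b Y x k lam mu.
have widen m l : (m <= l)%N -> (forall i, (m <= i)%N -> lam i = 0%N) ->
    \prod_(i < m) F i = \prod_(i < l) F i.
  move=> ml lm; rewrite (big_ord_widen _ F ml) big_mkcond; apply: eq_bigr => i _.
  by case: ltnP => // mi; rewrite /F row_weight_out // lm.
by case: (leqP p k.+1) => [pk|/ltnW kp]; [|apply/esym]; apply: widen.
Qed.

(** A cell with a cell of L below it cannot contain the largest entry and stays in M. So each
    removal moves the low cell up by at most one row, and a cell remains when no entries are
    left. *)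
Lemma peeledG_rows k (L : {set cell}) :
  (forall a c, below a c -> c \in L -> a \in L) ->
  (exists2 a, a \in L & (k <= a.1)%N) -> G k L = 0.
Proof.
elim: k L => [|k IHk] L up [a aL ka] /=.
  by case: eqP => // L0; rewrite L0 inE in aL.
rewrite big1 // => M _; rewrite big1 // => S /peelingP[e hr hb].
have above c c' : below c c' -> c' \in L -> c \in M.
  move=> cc' c'L; have cL := up _ _ cc' c'L.
  move: cL; rewrite -e inE => /orP[//|/hb/(_ cc')]; by rewrite c'L.
rewrite IHk ?mul0r // => [c c' cc' c'M|].
  by apply: above cc' _; rewrite -e inE c'M.
have a0 : (0 < a.1)%N by apply: leq_ltn_trans ka.
have ap : (a.1.-1 < p)%N by rewrite (leq_ltn_trans (leq_pred _)).
exists (Ordinal ap, a.2); last by rewrite -ltnS /= prednK.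
by apply: (above _ a) => //; rewrite /below /= eqxx andbT prednK.
Qed.

(** Inverse to forming the diagram, for left-justified sets of cells in the first k rows; a row has
    at most q cells, so [inord] keeps the count. *)
Definition row_lengths k (M : {set cell}) : {ffun 'I_k -> 'I_q.+1} :=
  [ffun i : 'I_k => inord (\sum_(a in M | a.1 == i :> nat) 1)%N].

Lemma row_lengths_diagram k (mu : {ffun 'I_k -> 'I_q.+1}) :
  (forall i : 'I_k, (p <= i)%N -> mu i = 0%N :> nat) ->
  row_lengths k (dia (ext0 mu)) = mu.
Proof.
move=> mu0; apply/ffunP => i; rewrite ffunE; apply/val_inj.
suff e : (\sum_(a in dia (ext0 mu) | a.1 == i :> nat) 1)%N = mu i.
  by rewrite e inord_val.
have [ip|pi] := ltnP i p; last first.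
  rewrite mu0 // big_pred0 // => a; apply/negbTE; rewrite negb_and orbC.
  by have := ltn_ord a.1; lia.
rewrite (eq_bigl (fun a : cell => (a.1 == Ordinal ip) && (a.2 < mu i)%N)) => [|a].
  rewrite -(pair_big_dep (fun j => j == Ordinal ip) (fun _ (j : 'I_q) => (j < mu i)%N)
    (fun _ _ => 1%N)) /= big_pred1_eq.
  rewrite -(big_ord_widen _ (fun=> 1%N)) ?sum1_card ?card_ord //.
  by rewrite -ltnS ltn_ord.
rewrite inE -val_eqE /= andbC; case: eqP => //= ->; by rewrite ext0_ord.
Qed.

Lemma diagram_row_lengths k (M : {set cell}) :
  (forall a c, right_of a c -> c \in M -> a \in M) ->
  (forall a, a \in M -> (a.1 < k)%N) ->
  M = dia (ext0 (row_lengths k M)).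
Proof.
move=> left rows; apply/setP => -[i j]; rewrite inE /=.
have [ik|ki] := ltnP i k; last first.
  by rewrite ext0_out // ltn0; apply/negbTE; apply: contraL ki => /rows; rewrite -ltnNge.
have -> : i = Ordinal ik :> nat by [].
rewrite ext0_ord ffunE /=.
have -> : (\sum_(a in M | a.1 == i :> nat) 1 = \sum_(j' < q) ((i, j') \in M))%N.
  rewrite (eq_bigl (fun a : cell => (a.1 == i) && ((i, a.2) \in M))) => [|[i' j']].
    rewrite -(pair_big_dep (fun i' => i' == i) (fun _ (j : 'I_q) => (i, j) \in M)
      (fun _ _ => 1%N)) /= big_pred1_eq big_mkcond.
    by apply: eq_bigr => j' _; case: (_ \in _).
  rewrite val_eqE /= andbC; by case: eqP => [->|_].
have down (j1 j2 : 'I_q) : (j1 <= j2)%N -> (i, j2) \in M -> (i, j1) \in M.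
  case: j2 => j2 j2q /=; elim: j2 j2q => [|j2 IHj] j2q.
    rewrite leqn0 => /eqP j10; congr ((i, _) \in M); exact/val_inj.
  rewrite leq_eqVlt => /predU1P[j1E|j12] h.
    by move: h; congr ((i, _) \in M); apply/val_inj; rewrite /= j1E.
  apply: (IHj (ltnW j2q)) => //; apply: left h.
  by rewrite /right_of /= !eqxx.
have bound : (\sum_(j' < q) ((i, j') \in M) < q.+1)%N.
  rewrite ltnS; apply: (@leq_trans (\sum_(j' < q) 1)%N).
    by apply: leq_sum => c _; apply: leq_b1.
  by rewrite sum1_card card_ord.
rewrite inordK //; apply/idP/idP => [jM|].
  rewrite -[leqLHS]subn0 -(card_ord_between 0 (ltn_ord j)).
  by apply: leq_sum => j' _; case: leqP => //= j'j; rewrite (down _ _ _ jM).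
apply: contraLR => jM; rewrite -leqNgt -[leqRHS]subn0.
rewrite -(card_ord_between 0 (ltnW (ltn_ord j))).
apply: leq_sum => j' _; case: (ltnP j' j) => [_|jj']; first exact: leq_b1.
by rewrite (contraNF (down _ _ jj')).
Qed.

Lemma vandermondeS k : vandermonde X k.+1 =
  vandermonde X k * \prod_(i < k) (X i.+1 - X k.+1).
Proof.
rewrite /vandermonde big_ord_recr /= [X in _ * X]big_pred0 ?mulr1 => [|j]; last first.
  by apply/negbTE; rewrite -leqNgt -ltnS ltn_ord.
rewrite -big_split; apply: eq_bigr => i _.
by rewrite big_mkcond big_ord_recr /= ltn_ord -big_mkcond.
Qed.

Hypothesis bX_lreg : forall i, GRing.lreg (1 + b * X i).

(** Induction on k: removing the largest entry and [bialternant_branching] give sums over the same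
    mu with the same row weights, and the additional Vandermonde factors agree. *)
Lemma peeledG_bialternant k lam :
  (forall i, lam i.+1 <= lam i)%N -> (lam 0 <= q)%N ->
  (forall i, (p <= i)%N -> lam i = 0%N) -> (forall i, (k <= i)%N -> lam i = 0%N) ->
  G k (dia lam) * vandermonde X k = bialternant b Y x k lam.
Proof.
elim: k lam => [|k IHk] lam lamS lamq lamp lamk.
  have -> : dia lam = set0 by apply/setP => a; rewrite !inE lamk.
  by rewrite /= eqxx /vandermonde big_ord0 /bialternant det_mx00 mulr1.
have reg : GRing.lreg ((1 + b * X k.+1) ^+ k) by apply: lregX.
apply: reg.
rewrite (@bialternant_branching _ _ _ _ _ q.+1) //; congr (_ * _).
rewrite vandermondeS mulrA mulrC; congr (_ * _).
have lam_q i : (lam i <= q)%N by elim: i => // i; apply: leq_trans.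
pose Phi M := \sum_(S | peeling (dia lam) M S)
  G k M * (b ^+ #|S :&: M| * \prod_(a in S) box_factor k a.1 a.2).
(* Only diagrams of interlacing mu contribute: any other M admits no peeling or has a cell in a row
   of index at least k, so that [G k M] is 0. *)
have -> : G k.+1 (dia lam) =
    \sum_(mu : {ffun 'I_k -> 'I_q.+1} | interlaces lam mu) Phi (dia (ext0 mu)).
  rewrite /= -/(Phi _); pose h (mu : {ffun 'I_k -> 'I_q.+1}) := dia (ext0 mu).
  rewrite (bigID (fun M => (M == h (row_lengths k M))
     && interlaces lam (row_lengths k M))) /= addrC big1 ?add0r => [|M MN]; last first.
    rewrite /Phi; apply: big1 => S /peelingP[e hr hb].
    have left a c : right_of a c -> c \in M -> a \in M.
      move=> ac cM; have : a \in dia lam.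
        have : c \in dia lam by rewrite -e inE cM.
        rewrite !inE; case/andP: ac => /eqP-> /eqP->; exact: ltnW.
      by rewrite -e inE => /orP[//|/hr/(_ ac)]; rewrite cM.
    have above a c : below a c -> c \in dia lam -> a \in M.
      move=> ac cL; have : a \in dia lam.
        move: cL; rewrite !inE; case/andP: ac => /eqP-> /eqP->.
        by move/leq_trans; apply.
      by rewrite -e inE => /orP[//|/hb/(_ ac)]; rewrite cL.
    have up a c : below a c -> c \in M -> a \in M.
      by move=> ac cM; apply: above ac _; rewrite -e inE cM.
    have [rows|] := boolP [forall a in M, (a.1 < k)%N]; last first.
      rewrite negb_forall_in => /exists_inP[a aM]; rewrite -leqNgt => ka.
      by rewrite peeledG_rows ?mul0r //; exists a.
    have ME := diagram_row_lengths left (fun a => forall_inP rows a).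
    case/negP: MN; apply/andP; split; first exact/eqP.
    apply/forallP => i; set mu := row_lengths k M in ME *.
    have inM (a : cell) : (a \in M) = (a.2 < ext0 mu a.1)%N by rewrite ME inE.
    apply/andP; split; rewrite leqNgt; apply/negP => lt.
      have iq : (mu i < q)%N by apply: leq_trans lt (lam_q _).
      have ip : (i.+1 < p)%N.
        by rewrite ltnNge; apply/negP => /lamp li; rewrite li in lt.
      have : (Ordinal (ltnW ip), Ordinal iq) \in M.
        apply: (above _ (Ordinal ip, Ordinal iq)); last by rewrite inE.
        by rewrite /below /= !eqxx.
      by rewrite inM /= (ext0_ord mu i) ltnn.
    have iq : (lam i < q)%N by apply: leq_trans lt _; rewrite -ltnS ltn_ord.
    have ip : (i < p)%N.
      rewrite ltnNge; apply/negP => pi; move: lt; rewrite /mu ffunE big_pred0.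
        by rewrite inordK.
      move=> a; apply/negbTE; rewrite negb_and orbC.
      by rewrite ltn_eqF // (leq_trans (ltn_ord _) pi).
    have : (Ordinal ip, Ordinal iq) \in dia lam.
      by rewrite -e inE inM /= (ext0_ord mu i) lt.
    by rewrite inE /= ltnn.
  rewrite (reindex_onto h (row_lengths k)) /= => [|M /andP[/eqP]//].
  apply: eq_bigl => mu; apply/andP/idP => [[/andP[_ +] /eqP muE]|inter].
    by rewrite muE.
  have muE : row_lengths k (h mu) = mu.
    apply: row_lengths_diagram => i /lamp li.
    by move/forallP: inter => /(_ i); rewrite li leqn0 => /andP[_ /eqP].
  by rewrite muE !eqxx inter.
rewrite mulr_suml; apply: eq_bigr => mu /forallP inter.
have inter' i : (lam i.+1 <= ext0 mu i <= lam i)%N.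
  have [ik|ki] := ltnP i k; first by have := inter (Ordinal ik); rewrite -ext0_ord.
  by rewrite ext0_out // lamk.
rewrite /Phi -mulr_sumr sum_peeling ?(lamp p) // prod_row_weight //; last first.
  by move=> i; case/andP: (inter' i).
rewrite mulrAC. rewrite (IHk (ext0 mu)). exact: mulrC.
- move=> i; case/andP: (inter' i) => + _; apply: leq_trans.
  by case/andP: (inter' i.+1).
- by apply: leq_trans (lam_q 0); case/andP: (inter' 0).
- by move=> i /lamp li; case/andP: (inter' i) => _; rewrite li leqn0 => /eqP.
- by move=> i; apply: ext0_out.
Qed.

End FactorialWeights.

(** * The stable limit *)

(** A non-empty S contributes a multiple of some z k, which phi kills; an empty S forces M = L with
    weight 1. *)
Lemma peeledG_stable (R : comNzRingType) (U : zmodType) (phi : {additive R -> U})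
    (b : R) (z : nat -> nat -> nat -> R) p q k (L : {set 'I_p * 'I_q}) :
  (forall (a : 'I_p * 'I_q) g, phi (z k a.1 a.2 * g) = 0) ->
  phi (peeledG b z k.+1 L) = phi (peeledG b z k L).
Proof.
move=> phi0; rewrite /= (bigD1 L) //= (bigD1 set0) /=; last first.
  apply/peelingP; split; first by rewrite setU0.
    by move=> a c; rewrite inE.
  by move=> a c; rewrite inE.
have vanish (M S : {set 'I_p * 'I_q}) : S != set0 ->
    phi (peeledG b z k M * (b ^+ #|S :&: M| * \prod_(a in S) z k a.1 a.2)) = 0.
  case/set0Pn => a aS; rewrite (bigD1 a) //= (mulrCA (b ^+ _)).
  by rewrite (mulrCA (peeledG _ _ _ _)).
rewrite !raddfD !raddf_sum /= set0I cards0 expr0 big_set0 !mulr1.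
rewrite [X in _ + X + _]big1 ?addr0 => [|S /andP[_ S0]]; last exact: vanish.
rewrite big1 ?addr0 // => M ML; rewrite raddf_sum; apply: big1 => S peel.
apply: vanish; apply: contraNneq ML => S0; case/peelingP: peel => <- _ _.
by rewrite S0 setU0.
Qed.

(** * The double Grothendieck polynomials as an instance *)

Definition rename (r : nat -> nat) (v : var) : var :=
  match v with inl i => inl (r i) | inr j => inr j end.

Definition act (r : nat -> nat) : {rmorphism bpoly -> bpoly} :=
  psubst (fun v => pvar (rename r v)).

Lemma act_beta r : act r beta = beta.
Proof. exact: psubst_beta. Qed.

Lemma act_px r j : act r (px j) = px (r j).
Proof. exact: psubst_var. Qed.

Lemma act_py r j : act r (py j) = py j.
Proof. exact: psubst_var. Qed.

Lemma eq_rename r r' : r =1 r' -> rename r =1 rename r'.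
Proof. by move=> e [i|j] //=; rewrite e. Qed.

Lemma eq_act r r' : r =1 r' -> act r =1 act r'.
Proof.
move=> e f; apply: eq_psubst => v; exact: (congr1 pvar (eq_rename e v)).
Qed.

Lemma act_comp r r' f : act r (act r' f) = act (r \o r') f.
Proof.
rewrite [LHS]psubst_comp; apply: eq_psubst => v.
apply: etrans (psubst_var _ _) _.
by apply: (congr1 pvar); case: v.
Qed.

Lemma act_id f : act id f = f.
Proof.
rewrite -[RHS]psubst_id; apply: eq_psubst => v.
by apply: (congr1 pvar); case: v.
Qed.

Lemma swap_varE i : swap_var i =1 rename (swap_nat i).
Proof.
have e a c : (inl a == inl c :> var) = (a == c) by apply/eqP/eqP => [[]|->].
case=> j //; rewrite /swap_var !e /=.
by case: eqP => [->|ji]; [|case: eqP => [->|ji']]; congr inl; swap_nat_cases; lia.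
Qed.

Lemma swapxE i f : swapx i f = act (swap_nat i) f.
Proof. apply: eq_psubst => v; exact: (congr1 pvar (swap_varE i v)). Qed.

Lemma swapx_divided_difference i f :
  exists g : bpoly, g * (px i - px i.+1) = f - act (swap_nat i) f.
Proof.
elim/bpoly_ind: f => [c|v|f f' [g Hg] [g' Hg']|f f' [g Hg] [g' Hg']].
- by exists 0; rewrite mul0r /act /= psubstC subrr.
- case: v => j; last by exists 0; rewrite mul0r act_py subrr.
  rewrite -/(px j) act_px; have [[-> ->]|[-> ->]|[_ _ ->]] := swap_natP i j.
  + by exists 1; rewrite mul1r.
  + by exists (-1); rewrite mulN1r opprB.
  + by exists 0; rewrite mul0r subrr.
- by exists (g + g'); rewrite rmorphD mulrDl Hg Hg' opprD addrACA.
- exists (g * f' + act (swap_nat i) f * g'); rewrite (rmorphM (act (swap_nat i)) f f').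
  exact: divided_difference_mul Hg Hg'.
Qed.

Lemma isobaricP i f : isobaric i f * (px i - px i.+1) =
  (1 + beta * px i.+1) * f - (1 + beta * px i) * act (swap_nat i) f.
Proof.
have h : exists g : bpoly, g * (px i - px i.+1) =
    (1 + beta * px i.+1) * f - (1 + beta * px i) * swapx i f.
  have [g Hg] := swapx_divided_difference i f.
  exists ((1 + beta * px i.+1) * g - beta * act (swap_nat i) f); rewrite swapxE.
  exact: isobaric_quotient Hg.
by rewrite -swapxE; apply: (epsilon_spec (inhabits (0 : bpoly)) _ h).
Qed.

Definition isobaric_braid := iso_braid act_beta act_px act_comp eq_act act_id
  pxB_lreg isobaricP.
Definition isobaric_comm := iso_comm act_beta act_px act_comp eq_act
  pxB_lreg isobaricP.

(** The choice operator needs some family satisfying the recursion; descent from the longest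
    permutation provides one. *)
Lemma double_grothendieckP n :
  @is_double_grothendieck n (@double_grothendieck n).
Proof.
apply: epsilon_spec.
exists (@descend_from_longest _ isobaric
  (\prod_(1 <= i < n.+1) \prod_(1 <= j < n.+1 | (i + j <= n)%N)
    oplus (px i) (py j)) n); split; first exact: descend_longest.
move=> w i iN; rewrite ascentP // => wi.
by apply: descend_ascent wi; [apply: isobaric_braid|apply: isobaric_comm].
Qed.

Lemma double_grothendieck_longest n : double_grothendieck (longest n) =
  \prod_(j < n) rising beta py 0 (n.-1 - j) (px j.+1).
Proof.
rewrite (proj1 (double_grothendieckP n)) big_add1 big_mkord.
apply: eq_bigr => i _; rewrite big_add1 /rising.
rewrite [RHS](big_nat_widen _ _ n); last by lia.
by apply: eq_bigl => j; rewrite /=; have := ltn_ord i; lia.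
Qed.

Lemma double_grothendieck_ascent n (w : 'S_n) i : ascent w i ->
  double_grothendieck w = isobaric i.+1 (double_grothendieck (simple_refl i * w)%g).
Proof.
move=> wi; have iN : (i.+1 < n)%N by case/andP: wi.
by apply: (proj2 (double_grothendieckP n)); rewrite ?ascentP.
Qed.

Lemma vandermonde_lreg k : GRing.lreg (vandermonde px k).
Proof.
rewrite /vandermonde; apply: big_ind => [|f g|i _]; [exact: lreg1|exact: lregM|].
apply: big_ind => [|f g|j ij]; [exact: lreg1|exact: lregM|].
by apply: pxB_lreg; rewrite eqSS neq_ltn ij.
Qed.

Lemma factorialG_peeledG la k : is_partition la -> factorialG la k =
  peeledG beta (box_factor beta px py) k
    (diagram (size la) (head 0%N la) (nth 0%N la)).
Proof. by move=> la_p; rewrite -svtableaux_peeledG. Qed.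

(** Both polynomials times the regular Vandermonde product are the same bialternant. *)
Lemma grassmannian_double_grothendieck la k n (w : 'S_n) : is_partition la ->
  (size la <= k <= n)%N -> represents w (grass_perm la k) ->
  double_grothendieck w = factorialG la k.
Proof.
move=> la_p /andP[sk kn] [wE _]; pose lam := nth 0%N la.
have lamS i : (lam i.+1 <= lam i)%N by apply: nth_partition.
have w_first (i : 'I_n) : (i < k)%N -> w i = (i + lam (k.-1 - i))%N :> nat.
  move=> ik; have := wE i; rewrite /grass_perm ik /part.
  by rewrite subSS -subn1 subnAC subn1 addSn => -[].
have w_last (i j : 'I_n) : (k <= i < j)%N -> (w i < w j)%N.
  move=> /andP[ki ij]; have := wE i; have := wE j.
  rewrite /grass_perm !ifN; [|lia..].
  have : (conj_part la (j.+1 - k) <= conj_part la (i.+1 - k))%N.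
    by apply: sub_count => x /=; apply: leq_trans; lia.
  lia.
have Dw := grassmannian_formula act_beta act_px act_py act_comp eq_act act_id
  pxB_lreg isobaricP (double_grothendieck_longest n) (@double_grothendieck_ascent n)
  kn two_lreg beta_lreg lamS w_first w_last.
have Gw := @peeledG_bialternant _ beta px py (size la) (head 0%N la)
  (fun i => @one_betaM_lreg (inl i)) k lam lamS (nth_le_head la_p 0)
  (fun i => @nth_default _ 0%N la i).
rewrite factorialG_peeledG //; apply: (@vandermonde_lreg k).
rewrite mulrC Dw -Gw; first exact: mulrC.
by move=> i ki; rewrite /lam nth_default // (leq_trans sk).
Qed.

(** The m additional leading values are fixed because parts beyond the length are 0. *)
Lemma represents_shift la p n m (w : 'S_n) : (size la <= p)%N ->
  represents w (grass_perm la p) ->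
  represents (shift_perm m w) (grass_perm la (p + m)).
Proof.
move=> sp [wE wfix]; split=> [i|i].
  rewrite permE /shift_fun; case: (split_ordP i) => j -> /=.
    rewrite /grass_perm ifT; last by have := ltn_ord j; lia.
    rewrite /part nth_default ?addn0 //; have := ltn_ord j; lia.
  have := wE j; rewrite /grass_perm.
  have -> : (m + j < p + m)%N = (j < p)%N by lia.
  have -> : ((p + m).+1 - (m + j).+1 = p.+1 - j.+1)%N by lia.
  have -> : ((m + j).+1 - (p + m) = j.+1 - p)%N by lia.
  case: ifP => _; lia.
move=> ni; have := wfix (i - m)%N; have ni' : (n < i - m)%N by lia.
move/(_ ni'); rewrite /grass_perm.
have -> : (i <= p + m)%N = (i - m <= p)%N by lia.
have -> : ((p + m).+1 - i = p.+1 - (i - m))%N by lia.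
have -> : (i - (p + m) = i - m - p)%N by lia.
case: ifP => _; lia.
Qed.

(** The antisymmetrization takes place in at most n variables. For non-empty la the permutation
    moves p, so p <= n; for empty la it is the identity for every p, and p' = 0 works. *)
Lemma represents_descent la p n (w : 'S_n) : is_partition la -> (size la <= p)%N ->
  represents w (grass_perm la p) ->
  exists2 p', (size la <= p' <= n)%N & represents w (grass_perm la p').
Proof.
move=> la_p sp wr; have [la0|la0] := eqVneq la [::].
  exists 0%N; first by rewrite la0.
  have e i : grass_perm la 0 i = grass_perm la p i.
    rewrite la0 /grass_perm /part /conj_part !nth_nil /= !addn0 !subn0.
    by rewrite !if_same.
  by case: wr => wE wfix; split=> [i|i /wfix]; rewrite e.
exists p => //; rewrite sp leqNgt; apply/negP => np.
have := proj2 wr p np; rewrite /grass_perm leqnn subSnn /part /=.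
case: la la_p sp la0 {wr} => // x la /andP[_ x0] _ _ /=.
by move: x0; rewrite inE negb_or => /andP[]; case: x => // x _ _; lia.
Qed.

(** * Stabilization of coefficients and the limit *)

Lemma pvarM_coef0 v (g : bpoly) (m : mon) : m v = 0%N -> (pvar v * g)@_m = 0.
Proof. by move=> mv; rewrite (pvarM_coef v g m) mv. Qed.

Lemma coefD0 (f g : bpoly) (m : mon) : f@_m = 0 -> g@_m = 0 -> (f + g)@_m = 0.
Proof. by move=> fm gm; rewrite mcoeffD fm gm addr0. Qed.

Lemma oplusM_coef (m : mon) i j (g : bpoly) : m (inl i) = 0%N -> m (inr j) = 0%N ->
  (oplus (px i) (py j) * g)@_m = 0.
Proof.
move=> mi mj; apply: etrans (congr1 (mcoeff m) (fsumM beta (px i) (py j) g)) _.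
exact: coefD0 (pvarM_coef0 _ mi) (pvarM_coef0 _ mj).
Qed.

Lemma mon_bound (m : mon) : exists B, forall i, (B <= i)%N ->
  m (inl i) = 0%N /\ m (inr i) = 0%N.
Proof.
pose ind (v : var) := match v with inl i => i | inr i => i end.
exists (\max_(v <- finsupp (cmonom_val m)) (ind v).+1)%N => i Bi.
have out v : (ind v = i) -> m v = 0%N.
  move=> vi; apply/eqP; rewrite cmE_eq0; apply/negP => h; move: Bi; rewrite leqNgt.
  move/negP; apply; rewrite -vi.
  exact: (@leq_bigmax_seq _ _ predT (fun v : var => (ind v).+1) v h).
by split; apply: out.
Qed.

(** Let B exceed all indices of variables in m. For k >= B + size la the entry k + 1 contributes a
    factor x_(k+1) (+) y_j, and j >= B because contents exceed -size la. *)
Lemma factorialG_stable la (m : mon) : is_partition la ->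
  exists K, forall k, (K <= k)%N -> (factorialG la k)@_m = (factorialG la K)@_m.
Proof.
move=> la_p; have [B mB] := mon_bound m; exists (B + size la)%N => k.
elim: k => [|k IHk]; first by rewrite leqn0 => /eqP->.
rewrite leq_eqVlt => /predU1P[->//|Bk]; rewrite -IHk // !factorialG_peeledG //.
apply: (@peeledG_stable _ _ (mcoeff m)) => a g; apply: oplusM_coef.
  by case: (mB k.+1); first lia.
by have a1 := ltn_ord a.1; case: (mB (k.+1 + a.2 - a.1)%N) => //; lia.
Qed.

Theorem theorem8p7 (la : seq nat) (p N : nat) (w : 'S_N.+1) :
  is_partition la -> (size la <= p)%N -> represents w (grass_perm la p) ->
  converges (factorialG la) (stableG w).
Proof.
move=> la_p sp /(represents_descent la_p sp)[p' /andP[sp' p'N] wr] {p sp}.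
have uE m : double_grothendieck (shift_perm m w) = factorialG la (p' + m).
  apply: grassmannian_double_grothendieck => //; last exact: represents_shift.
  lia.
have lim : converges (fun m => double_grothendieck (shift_perm m w)) (stableG w).
  (* The stable series is a chosen limit, so one must be exhibited: its coefficient at m is read off
     at a stabilizing index. *)
  apply: epsilon_spec.
  pose K m := epsilon (inhabits 0%N) (fun K => forall k, (K <= k)%N ->
    (factorialG la k)@_m = (factorialG la K)@_m).
  have KP m : forall k, (K m <= k)%N ->
      (factorialG la k)@_m = (factorialG la (K m))@_m.
    exact: (epsilon_spec _ _ (factorialG_stable m la_p)).
  exists (fun m => (factorialG la (K m))@_m) => m; exists (K m) => k Kk.
  by rewrite uE KP //; lia.
move=> m; have [K hK] := lim m; exists (p' + K)%N => k Kk.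
rewrite -(hK (k - p')%N); last by lia.
by rewrite uE subnKC //; lia.
Qed.
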